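(* Let $H$ be a bialgebra over a field $K$, let $A$ be an $H$-comodule-coalgebra with structure map $\rho$, and let $R_t=\sum_{i=0}^\infty\rho_it^i$ be a deformation of $A$ as an $H$-comodule-coalgebra. Then the infinitesimal $\rho_1$ is a $1$-cocycle in $\mathcal{F}^1_{cc}(A)$ whose cohomology class in $H^1(\mathcal{F}^\bullet_{cc}(A))$ is determined by the equivalence class of $R_t$ (equivalent deformations have cohomologous infinitesimals). Moreover: (1) If $H^2_c(A,A)$ and $H^1(\mathcal{F}^\bullet_{cc}(A))$ are both trivial, then $A$ is rigid, i.e. every deformation of $A$ is equivalent to the trivial deformation $R_t=\rho$. (2) If $H^2(\mathcal{F}^\bullet_{cc}(A))$ is trivial, then every $1$-cocycle in $\mathcal{F}^1_{cc}(A)$ is the infinitesimal of some deformation of $A$.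
   Context: Fix a field $K$; $\otimes$ and $\mathrm{Hom}$ are over $K$. $(H,\mu_H,\Delta_H)$ is a $K$-bialgebra and $(A,\Delta_A)$ a (coassociative) coalgebra. $\tau:A\otimes H\to H\otimes A$ and $\tau_n:A^{\otimes n}\otimes H\to H\otimes A^{\otimes n}$ are the twists $\mathbf{a}\otimes x\mapsto x\otimes\mathbf{a}$. An $H$-comodule-coalgebra structure on $A$ is an $H$-comodule structure $\rho:A\to H\otimes A$ such that $$(\mathrm{Id}_H\otimes\Delta_A)\circ\rho=(\mu_H\otimes\mathrm{Id}_{A^{\otimes2}})\circ(\mathrm{Id}_H\otimes\tau\otimes\mathrm{Id}_A)\circ\rho^{\otimes2}\circ\Delta_A.$$ A deformation of $A$ is a power series $R_t=\sum_{i\ge0}\rho_it^i$ with $\rho_0=\rho$, each $\rho_i\in\mathrm{Hom}(A,H\otimes A)$, satisfying (maps extended linearly to power series) $$(\mathrm{Id}_H\otimes R_t)\circ R_t=(\Delta_H\otimes\mathrm{Id}_A)\circ R_t,$$ $$(\mathrm{Id}_H\otimes\Delta_A)\circ R_t=(\mu_H\otimes\mathrm{Id}_{A^{\otimes2}})\circ(\mathrm{Id}_H\otimes\tau\otimes\mathrm{Id}_A)\circ R_t^{\otimes2}\circ\Delta_A.$$ Its infinitesimal is $\rho_1$. A formal automorphism of $A$ is a power series $\Phi_t=\sum_{i\ge0}\phi_it^i$ with $\phi_0=\mathrm{Id}_A$, each $\phi_i\in\mathrm{End}(A)$ (linear endomorphisms), and $\Delta_A\circ\Phi_t=\Phi_t^{\otimes2}\circ\Delta_A$.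 Deformations $R_t,\overline{R}_t$ are equivalent if $\overline{R}_t=(\mathrm{Id}_H\otimes\Phi_t^{-1})\circ R_t\circ\Phi_t$ for some formal automorphism $\Phi_t$. Cochain complex $\mathcal{F}^\bullet_{cc}(A)$: $\mathcal{F}^0_{cc}(A)=\mathrm{Coder}(A)$, the linear maps $\varphi:A\to A$ with $\Delta_A\circ\varphi=(\mathrm{Id}_A\otimes\varphi+\varphi\otimes\mathrm{Id}_A)\circ\Delta_A$; $\mathcal{F}^1_{cc}(A)=\mathrm{Hom}(A,H\otimes A)$; for $n\ge2$, $\mathcal{F}^n_{cc}(A)=\mathrm{Hom}(A,H^{\otimes n}\otimes A)\oplus\mathrm{Hom}(A,H\otimes A^{\otimes n})$. Differentials: $d^0_{cc}\phi=\rho\circ\phi-(\mathrm{Id}_H\otimes\phi)\circ\rho$; for $n\ge1$, $d^n_{cc}(\varphi_0;\varphi_1)=(d^n_{cc,0}\varphi_0;d^n_{cc,1}\varphi_1)$ (for $n=1$, $\varphi_0=\varphi_1=\varphi$), where $$d^n_{cc,0}\varphi_0=(\mathrm{Id}_{H^{\otimes n}}\otimes\rho)\circ\varphi_0+\sum_{i=1}^n(-1)^i(\mathrm{Id}_{H^{\otimes(n-i)}}\otimes\Delta_H\otimes\mathrm{Id}_{H^{\otimes(i-1)}\otimes A})\circ\varphi_0+(-1)^{n+1}(\mathrm{Id}_H\otimes\varphi_0)\circ\rho,$$ $$d^n_{cc,1}\varphi_1=(\mu_H\otimes\mathrm{Id}_{A^{\otimes(n+1)}})\circ(\mathrm{Id}_H\otimes\tau\otimes\mathrm{Id}_{A^{\otimes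 n}})\circ(\rho\otimes\varphi_1)\circ\Delta_A+\sum_{i=1}^n(-1)^i(\mathrm{Id}_{H\otimes A^{\otimes(i-1)}}\otimes\Delta_A\otimes\mathrm{Id}_{A^{\otimes(n-i)}})\circ\varphi_1+(-1)^{n+1}(\mu_H\otimes\mathrm{Id}_{A^{\otimes(n+1)}})\circ(\mathrm{Id}_H\otimes\tau_n\otimes\mathrm{Id}_A)\circ(\varphi_1\otimes\rho)\circ\Delta_A.$$ Hochschild coalgebra cohomology $H^\bullet_c(A,A)$: the cohomology of the complex $C^0_c(A,A)=0$, $C^n_c(A,A)=\mathrm{Hom}(A,A^{\otimes n})$ for $n\ge1$, with differential $$\delta_c\sigma=(\mathrm{Id}_A\otimes\sigma)\circ\Delta_A+\sum_{i=1}^n(-1)^i(\mathrm{Id}_{A^{\otimes(i-1)}}\otimes\Delta_A\otimes\mathrm{Id}_{A^{\otimes(n-i)}})\circ\sigma+(-1)^{n+1}(\sigma\otimes\mathrm{Id}_A)\circ\Delta_A.$$ *)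

(* Defs.v *)
From HB Require Import structures.
From mathcomp Require Import all_boot all_algebra.
From mathcomp Require Import boolp.

Set Implicit Arguments.
Unset Strict Implicit.
Unset Printing Implicit Defensive.

Import GRing.Theory.
Local Open Scope ring_scope.
Local Open Scope quotient_scope.

Section Hom.
Context {K : fieldType}.
Implicit Types U V W : lmodType K.

Lemma lin_ext U V (f g : {linear U -> V}) : f =1 g -> f = g.
Proof.
case: f g => [f [[p1] [p2]]] [g [[q1] [q2]]] /= /funext fg; subst g.
by rewrite (Prop_irrelevance p1 q1) (Prop_irrelevance p2 q2).
Qed.

Definition mklin U V (f : U -> V) (f_lin : linear f) : {linear U -> V} :=
  HB.pack f (GRing.isLinear.Build K U V *:%R f f_lin).

Definition lid U : {linear U -> U} := idfun.

Definition lcomp U V W (g : {linear V -> W}) (f : {linear U -> V}) :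
  {linear U -> W} := g \o f.

End Hom.

Section HomLmod.
Context {K : fieldType} (U V : lmodType K).
Implicit Types f g h : {linear U -> V}.

HB.instance Definition _ := gen_eqMixin {linear U -> V}.
HB.instance Definition _ := gen_choiceMixin {linear U -> V}.

Definition lin_zero : {linear U -> V} := \0.
Definition lin_opp f : {linear U -> V} := \- f.
Definition lin_add f g : {linear U -> V} := f \+ g.
Definition lin_scale (a : K) f : {linear U -> V} := a \*: f.

Fact lin_addA : associative lin_add.
Proof. by move=> f g h; apply: lin_ext => x /=; rewrite addrA. Qed.
Fact lin_addC : commutative lin_add.
Proof. by move=> f g; apply: lin_ext => x /=; rewrite addrC. Qed.
Fact lin_add0 : left_id lin_zero lin_add.
Proof. by move=> f; apply: lin_ext => x /=; rewrite add0r. Qed.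
Fact lin_addN : left_inverse lin_zero lin_opp lin_add.
Proof. by move=> f; apply: lin_ext => x /=; rewrite addNr. Qed.

HB.instance Definition _ := GRing.isZmodule.Build {linear U -> V}
  lin_addA lin_addC lin_add0 lin_addN.

Fact lin_scaleA a b f : lin_scale a (lin_scale b f) = lin_scale (a * b) f.
Proof. by apply: lin_ext => x /=; rewrite scalerA. Qed.
Fact lin_scale1 : left_id 1 lin_scale.
Proof. by move=> f; apply: lin_ext => x /=; rewrite scale1r. Qed.
Fact lin_scaleDr : right_distributive lin_scale +%R.
Proof. by move=> a f g; apply: lin_ext => x /=; rewrite scalerDr. Qed.
Fact lin_scaleDl f : {morph lin_scale^~ f : a b / a + b}.
Proof. by move=> a b; apply: lin_ext => x /=; rewrite scalerDl. Qed.

HB.instance Definition _ := GRing.Zmodule_isLmodule.Build K {linear U -> V}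
  lin_scaleA lin_scale1 lin_scaleDr lin_scaleDl.

Lemma linD f g x : (f + g) x = f x + g x. Proof. by []. Qed.
Lemma linN f x : (- f) x = - f x. Proof. by []. Qed.
Lemma linZ a f x : (a *: f) x = a *: f x. Proof. by []. Qed.
Lemma lin0 x : (0 : {linear U -> V}) x = 0. Proof. by []. Qed.
Lemma lin_sum (I : Type) (r : seq I) (P : pred I) (F : I -> {linear U -> V}) x :
  (\sum_(i <- r | P i) F i) x = \sum_(i <- r | P i) F i x.
Proof. by elim/big_rec2: _ => // i y f _ <-. Qed.

End HomLmod.

Section Tensor.
Context {K : fieldType} (U V : lmodType K).

(* The list [(u_1, v_1); ...; (u_n, v_n)] stands for the formal sum of the
   u_i (x) v_i; [tens_rel] is the congruence generated by bilinearity. *)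
Inductive tens_rel : seq (U * V) -> seq (U * V) -> Prop :=
| tens_rel_refl s : tens_rel s s
| tens_rel_sym s t : tens_rel s t -> tens_rel t s
| tens_rel_trans s t r : tens_rel s t -> tens_rel t r -> tens_rel s r
| tens_rel_cat s s' t t' :
    tens_rel s s' -> tens_rel t t' -> tens_rel (s ++ t) (s' ++ t')
| tens_rel_catC s t : tens_rel (s ++ t) (t ++ s)
| tens_rel_addl u u' v : tens_rel [:: (u + u', v)] [:: (u, v); (u', v)]
| tens_rel_addr u v v' : tens_rel [:: (u, v + v')] [:: (u, v); (u, v')]
| tens_rel_scale a u v : tens_rel [:: (a *: u, v)] [:: (u, a *: v)]
| tens_rel_zero v : tens_rel [:: (0, v)] [::].

Definition tens_relb s t := `[< tens_rel s t >].

Fact tens_relb_refl : reflexive tens_relb.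
Proof. by move=> s; apply/asboolP; exact: tens_rel_refl. Qed.
Fact tens_relb_sym : symmetric tens_relb.
Proof. by move=> s t; apply/asboolP/asboolP; exact: tens_rel_sym. Qed.
Fact tens_relb_trans : transitive tens_relb.
Proof.
move=> t s r /asboolP st /asboolP tr; apply/asboolP; exact: tens_rel_trans tr.
Qed.

Canonical tens_equiv :=
  EquivRel tens_relb tens_relb_refl tens_relb_sym tens_relb_trans.

Definition tensor : Type := {eq_quot tens_equiv}.
HB.instance Definition _ := Choice.on tensor.

Definition tclass (s : seq (U * V)) : tensor := \pi_({eq_quot tens_equiv}) s.
Definition trepr (x : tensor) : seq (U * V) :=
  repr (x : {eq_quot tens_equiv}).

Fact treprK : cancel trepr tclass. Proof. exact: reprK. Qed.

Fact tclassP s t : tclass s = tclass t <-> tens_rel s t.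
Proof.
split=> [/eqmodP /asboolP //|st]; exact/eqmodP/asboolP.
Qed.

Fact trepr_class s : tens_rel (trepr (tclass s)) s.
Proof. by apply/tclassP; rewrite treprK. Qed.

Definition tens_map (f : U -> U) (s : seq (U * V)) := [seq (f p.1, p.2) | p <- s].

Fact tens_rel_map_scale a s t :
  tens_rel s t -> tens_rel (tens_map ( *:%R a) s) (tens_map ( *:%R a) t).
Proof.
elim=> {s t} /= [s|s t _|s t r _ st _|s s' t t' _ IHs _ IHt|s t|u u' v|u v v'|b u v|v].
- exact: tens_rel_refl.
- exact: tens_rel_sym.
- exact: tens_rel_trans.
- by rewrite /tens_map !map_cat; exact: tens_rel_cat.
- by rewrite /tens_map !map_cat; exact: tens_rel_catC.
- by rewrite scalerDr; exact: tens_rel_addl.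
- exact: tens_rel_addr.
- by rewrite scalerA mulrC -scalerA; exact: tens_rel_scale.
- by rewrite scaler0; exact: tens_rel_zero.
Qed.

Definition tens_zero : tensor := tclass [::].
Definition tens_add (x y : tensor) := tclass (trepr x ++ trepr y).
Definition tens_scale a (x : tensor) := tclass (tens_map ( *:%R a) (trepr x)).
Definition tens_opp (x : tensor) := tens_scale (-1) x.

Fact tens_addE s t : tens_add (tclass s) (tclass t) = tclass (s ++ t).
Proof. by apply/tclassP/tens_rel_cat; exact: trepr_class. Qed.
Fact tens_scaleE a s : tens_scale a (tclass s) = tclass (tens_map ( *:%R a) s).
Proof. by apply/tclassP/tens_rel_map_scale; exact: trepr_class. Qed.

Fact tens_addA : associative tens_add.
Proof.
move=> x y z; rewrite -[x]treprK -[y]treprK -[z]treprK.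
by rewrite !tens_addE catA.
Qed.
Fact tens_addC : commutative tens_add.
Proof.
move=> x y; rewrite -[x]treprK -[y]treprK !tens_addE.
by apply/tclassP; exact: tens_rel_catC.
Qed.
Fact tens_add0 : left_id tens_zero tens_add.
Proof. by move=> x; rewrite -[x]treprK tens_addE. Qed.

Fact tclass_cons p s : tclass (p :: s) = tens_add (tclass [:: p]) (tclass s).
Proof. by rewrite tens_addE. Qed.
Fact tens_scaleDr : right_distributive tens_scale tens_add.
Proof.
move=> a x y; rewrite -[x]treprK -[y]treprK.
by rewrite !(tens_scaleE, tens_addE) /tens_map map_cat.
Qed.
Fact tens_scaleDl x : {morph tens_scale^~ x : a b / a + b >-> tens_add a b}.
Proof.
move=> a b; rewrite -[x]treprK !tens_scaleE.
elim: (trepr x) => [|[u v] s IHs]; first by rewrite /tens_map /= tens_addE.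
rewrite /= (tclass_cons _ (tens_map ( *:%R (a + b)) s)).
rewrite (tclass_cons _ (tens_map ( *:%R a) s)).
rewrite (tclass_cons _ (tens_map ( *:%R b) s)) IHs scalerDl.
have -> : tclass [:: (a *: u + b *: u, v)] =
    tens_add (tclass [:: (a *: u, v)]) (tclass [:: (b *: u, v)]).
  by rewrite tens_addE; apply/tclassP; exact: tens_rel_addl.
rewrite -!tens_addA; congr (tens_add _ _); rewrite !tens_addA.
by congr (tens_add _ _); exact: tens_addC.
Qed.
Fact tens_scaleA a b x : tens_scale a (tens_scale b x) = tens_scale (a * b) x.
Proof.
rewrite -[x]treprK !tens_scaleE; congr tclass; rewrite /tens_map -map_comp.
by apply: eq_map => p /=; rewrite scalerA.
Qed.
Fact tens_scale1 : left_id 1 tens_scale.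
Proof.
move=> x; rewrite -[x]treprK tens_scaleE /tens_map; congr tclass.
by rewrite -[RHS]map_id; apply: eq_map => -[u v] /=; rewrite scale1r.
Qed.
Fact tens_scale0 x : tens_scale 0 x = tens_zero.
Proof.
rewrite -[x]treprK tens_scaleE; elim: (trepr x) => [//|[u v] s IHs].
rewrite /= tclass_cons IHs scale0r tens_addC tens_add0.
by apply/tclassP; exact: tens_rel_zero.
Qed.
Fact tens_addN : left_inverse tens_zero tens_opp tens_add.
Proof.
move=> x; rewrite -{2}[x]tens_scale1 /tens_opp -tens_scaleDl.
by rewrite addNr tens_scale0.
Qed.

HB.instance Definition _ := GRing.isZmodule.Build tensor
  tens_addA tens_addC tens_add0 tens_addN.
HB.instance Definition _ := GRing.Zmodule_isLmodule.Build K tensor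
  tens_scaleA tens_scale1 tens_scaleDr tens_scaleDl.

Definition tens (u : U) (v : V) : tensor := tclass [:: (u, v)].

Lemma tensDl u u' v : tens (u + u') v = tens u v + tens u' v.
Proof.
by rewrite /GRing.add /= tens_addE; apply/tclassP; exact: tens_rel_addl.
Qed.
Lemma tensDr u v v' : tens u (v + v') = tens u v + tens u v'.
Proof.
by rewrite /GRing.add /= tens_addE; apply/tclassP; exact: tens_rel_addr.
Qed.
Lemma tensZl a u v : tens (a *: u) v = a *: tens u v.
Proof. by rewrite [RHS]/GRing.scale /= tens_scaleE. Qed.
Lemma tensZr a u v : tens u (a *: v) = a *: tens u v.
Proof. by rewrite -tensZl; apply/tclassP/tens_rel_sym/tens_rel_scale. Qed.

Lemma tensor_sum (x : tensor) : x = \sum_(p <- trepr x) tens p.1 p.2.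
Proof.
rewrite -{1}[x]treprK; elim: (trepr x) => [|[u v] s IHs]; first by rewrite big_nil.
by rewrite big_cons -IHs [RHS]/GRing.add /= tens_addE.
Qed.

Lemma tensor_ext (W : lmodType K) (f g : {linear tensor -> W}) :
  (forall u v, f (tens u v) = g (tens u v)) -> f = g.
Proof.
move=> fg; apply: lin_ext => x; rewrite [x]tensor_sum !linear_sum.
by apply: eq_bigr.
Qed.

Section Lift.
Context (W : lmodType K) (b : U -> V -> W).
Hypotheses (bl : forall v, linear (b^~ v)) (br : forall u, linear (b u)).

Definition tlift_fun (x : tensor) : W := \sum_(p <- trepr x) b p.1 p.2.

Fact tlift_rel s t : tens_rel s t ->
  \sum_(p <- s) b p.1 p.2 = \sum_(p <- t) b p.1 p.2.
Proof.
have b0 v : b 0 v = 0.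
  by have := bl v (-1) 0 0; rewrite scaler0 addr0 scaleN1r addNr.
have bDl u u' v : b (u + u') v = b u v + b u' v.
  by have := bl v 1 u u'; rewrite !scale1r.
have bDr u v v' : b u (v + v') = b u v + b u v'.
  by have := br u 1 v v'; rewrite !scale1r.
have bZl a u v : b (a *: u) v = a *: b u v.
  by have := bl v a u 0; rewrite addr0 b0 addr0.
have bZr a u v : b u (a *: v) = a *: b u v.
  have bu0 : b u 0 = 0.
    by have := br u (-1) 0 0; rewrite scaler0 addr0 scaleN1r addNr.
  by have := br u a v 0; rewrite addr0 bu0 addr0.
elim=> {s t} [//|s t _ -> //|s t r _ -> _ -> //|s s' t t' _ es _ et|s t|u u' v|u v v'|a u v|v].
- by rewrite !big_cat /= es et.
- by rewrite !big_cat /= addrC.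
- by rewrite !big_cons !big_nil !addr0 bDl.
- by rewrite !big_cons !big_nil !addr0 bDr.
- by rewrite !big_cons !big_nil !addr0 bZl bZr.
- by rewrite !big_cons !big_nil !addr0 b0.
Qed.

Fact tlift_class s : tlift_fun (tclass s) = \sum_(p <- s) b p.1 p.2.
Proof. exact: tlift_rel (trepr_class s). Qed.

Fact tlift_linear : linear tlift_fun.
Proof.
have bZl a u v : b (a *: u) v = a *: b u v.
  have b0 : b 0 v = 0.
    by have := bl v (-1) 0 0; rewrite scaler0 addr0 scaleN1r addNr.
  by have := bl v a u 0; rewrite addr0 b0 addr0.
move=> a x y; rewrite -[x]treprK -[y]treprK.
rewrite [_ *: _]/GRing.scale /= tens_scaleE.
rewrite [X in tlift_fun X]/GRing.add /= tens_addE.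
rewrite !tlift_class big_cat /= scaler_sumr /tens_map big_map.
by congr (_ + _); apply: eq_bigr => p _ /=; rewrite bZl.
Qed.

Definition tlift : {linear tensor -> W} := mklin tlift_linear.

Lemma tliftE u v : tlift (tens u v) = b u v.
Proof. by rewrite /= tlift_class big_seq1. Qed.

End Lift.

End Tensor.

Notation "U \ox V" := (tensor U V)
  (at level 40, left associativity) : type_scope.
Notation "g \oL f" := (lcomp g f)
  (at level 45, left associativity) : ring_scope.

Arguments lid {K}.
Arguments lin_ext {K U V f g}.

Section TensorMaps.
Context {K : fieldType}.
Implicit Types U V W X : lmodType K.

Lemma lcompE U V W (g : {linear V -> W}) (f : {linear U -> V}) x :
  (g \oL f) x = g (f x).
Proof. by []. Qed.

Fact tens_linl U V (v : V) : linear (fun u : U => tens u v).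
Proof. by move=> a u u'; rewrite tensDl tensZl. Qed.
Fact tens_linr U V (u : U) : linear (fun v : V => tens u v).
Proof. by move=> a v v'; rewrite tensDr tensZr. Qed.

Section TMap.
Context U U' V V' (f : {linear U -> U'}) (g : {linear V -> V'}).
Fact tmap_linl v : linear (fun u => tens (f u) (g v)).
Proof. by move=> a u u'; rewrite linearP tens_linl. Qed.
Fact tmap_linr u : linear (fun v => tens (f u) (g v)).
Proof. by move=> a v v'; rewrite linearP tens_linr. Qed.
Definition tmap : {linear U \ox V -> U' \ox V'} := tlift tmap_linl tmap_linr.
Lemma tmapE u v : tmap (tens u v) = tens (f u) (g v).
Proof. exact: tliftE. Qed.
End TMap.

Section Assoc.
Context U V W.

Fact tassoc_lin1 (w : W) (v : V) : linear (fun u : U => tens u (tens v w)).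
Proof. exact: tens_linl. Qed.
Fact tassoc_lin2 (w : W) (u : U) : linear (fun v : V => tens u (tens v w)).
Proof. by move=> a v v'; rewrite tens_linl tens_linr. Qed.
Fact tassoc_lin3 (w : W) :
  linear (fun x => tlift (tassoc_lin1 w) (tassoc_lin2 w) x).
Proof. by move=> a x y; rewrite linearP. Qed.
Fact tassoc_lin4 (x : U \ox V) :
  linear (fun w => tlift (tassoc_lin1 w) (tassoc_lin2 w) x).
Proof.
move=> a w w'.
rewrite -[RHS](linD (a *: tlift (tassoc_lin1 w) (tassoc_lin2 w))).
congr (GRing.Linear.sort _ x); apply: tensor_ext => u v.
by rewrite linD linZ !tliftE !tens_linr.
Qed.
Definition tassoc : {linear U \ox V \ox W -> U \ox (V \ox W)} :=
  tlift tassoc_lin3 tassoc_lin4.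
Lemma tassocE u v w : tassoc (tens (tens u v) w) = tens u (tens v w).
Proof. by rewrite !tliftE. Qed.

Fact tassocV_lin1 (u : U) (w : W) : linear (fun v : V => tens (tens u v) w).
Proof. by move=> a v v'; rewrite tens_linr tens_linl. Qed.
Fact tassocV_lin2 (u : U) (v : V) : linear (fun w : W => tens (tens u v) w).
Proof. exact: tens_linr. Qed.
Fact tassocV_lin3 (u : U) :
  linear (fun x => tlift (tassocV_lin1 u) (tassocV_lin2 u) x).
Proof. by move=> a x y; rewrite linearP. Qed.
Fact tassocV_lin4 (x : V \ox W) :
  linear (fun u => tlift (tassocV_lin1 u) (tassocV_lin2 u) x).
Proof.
move=> a u u'.
rewrite -[RHS](linD (a *: tlift (tassocV_lin1 u) (tassocV_lin2 u))).
congr (GRing.Linear.sort _ x); apply: tensor_ext => v w.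
by rewrite linD linZ !tliftE !tens_linl.
Qed.
Definition tassocV : {linear U \ox (V \ox W) -> U \ox V \ox W} :=
  tlift tassocV_lin4 tassocV_lin3.
Lemma tassocVE u v w : tassocV (tens u (tens v w)) = tens (tens u v) w.
Proof. by rewrite !tliftE. Qed.

End Assoc.

Definition ttwist U V : {linear U \ox V -> V \ox U} :=
  tlift (fun v => @tens_linr V U v) (fun u => @tens_linl V U u).
Lemma ttwistE U V (u : U) (v : V) : ttwist U V (tens u v) = tens v u.
Proof. exact: tliftE. Qed.

End TensorMaps.

Notation "f \ot g" := (tmap f g) (at level 40, left associativity) : ring_scope.

Section HomBilinear.
Context {K : fieldType}.
Implicit Types U V W X : lmodType K.

Lemma lcomp_linr U V W (g : {linear V -> W}) :
  linear (fun f : {linear U -> V} => g \oL f).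
Proof. by move=> a f f'; apply: lin_ext => x; rewrite lcompE !linearP. Qed.
Lemma lcomp_linl U V W (f : {linear U -> V}) :
  linear (fun g : {linear V -> W} => g \oL f).
Proof. by move=> a g g'; apply: lin_ext. Qed.
Lemma tmap_linmr U U' V V' (f : {linear U -> U'}) :
  linear (fun g : {linear V -> V'} => f \ot g).
Proof.
move=> a g g'; apply: tensor_ext => u v.
by rewrite linD linZ !tmapE linD linZ tens_linr.
Qed.
Lemma tmap_linml U U' V V' (g : {linear V -> V'}) :
  linear (fun f : {linear U -> U'} => f \ot g).
Proof.
move=> a f f'; apply: tensor_ext => u v.
by rewrite linD linZ !tmapE linD linZ tens_linl.
Qed.

Lemma lin_funD U V (f g : U -> V) :
  linear f -> linear g -> linear (fun x => f x + g x).
Proof. by move=> fl gl a x y; rewrite fl gl scalerDr addrACA. Qed.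
Lemma lin_funZ U V c (f : U -> V) : linear f -> linear (fun x => c *: f x).
Proof. by move=> fl a x y; rewrite fl scalerDr !scalerA mulrC. Qed.
Lemma lin_fun_sum U V (I : Type) (r : seq I) (f : I -> U -> V) :
  (forall i, linear (f i)) -> linear (fun x => \sum_(i <- r) f i x).
Proof.
move=> fl a x y; rewrite scaler_sumr -big_split.
by apply: eq_bigr => i _; rewrite fl.
Qed.

End HomBilinear.

Section Structures.
Context {K : fieldType} {H A : lmodType K}.
Variables (muH : {linear H \ox H -> H}) (DeltaA : {linear A -> A \ox A}).

Definition coassociative :=
  (lid A \ot DeltaA) \oL DeltaA = tassoc A A A \oL (DeltaA \ot lid A) \oL DeltaA.

(* Id (x) tau (x) Id *)
Definition interchange (U V W X : lmodType K) :
    {linear (U \ox V) \ox (W \ox X) -> (U \ox W) \ox (V \ox X)} :=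
  tassocV U W (V \ox X)
  \oL (lid U \ot (tassoc W V X \oL (ttwist V W \ot lid X) \oL tassocV V W X))
  \oL tassoc U V (W \ox X).

Lemma interchangeE (U V W X : lmodType K) (u : U) (v : V) (w : W) (x : X) :
  interchange U V W X (tens (tens u v) (tens w x)) =
  tens (tens u w) (tens v x).
Proof.
rewrite /interchange !lcompE tassocE tmapE !lcompE tassocVE tmapE ttwistE.
by rewrite tassocE tassocVE.
Qed.

(* (mu_H (x) Id) o (Id_H (x) tau (x) Id) : (h (x) u) (x) (h' (x) v) |->
   h h' (x) (u (x) v) *)
Definition mulcomb (U V : lmodType K) :
    {linear (H \ox U) \ox (H \ox V) -> H \ox (U \ox V)} :=
  (muH \ot lid (U \ox V)) \oL interchange H U H V.

End Structures.

(* As for coalgebras and comodules here, neither a unit nor a counit is part of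
   the structure: none of the equations below involves one. *)
Record bialgebra {K : fieldType} {H : lmodType K}
    (muH : {linear H \ox H -> H}) (DeltaH : {linear H -> H \ox H}) : Prop :=
  Bialgebra {
    bialgebra_mulA :
      muH \oL (muH \ot lid H) = muH \oL (lid H \ot muH) \oL tassoc H H H;
    bialgebra_coassoc : coassociative DeltaH;
    bialgebra_compat :
      DeltaH \oL muH =
      (muH \ot muH) \oL interchange H H H H \oL (DeltaH \ot DeltaH)
  }.

Record comodule_coalgebra {K : fieldType} {H A : lmodType K}
    (muH : {linear H \ox H -> H}) (DeltaH : {linear H -> H \ox H})
    (DeltaA : {linear A -> A \ox A}) (rho : {linear A -> H \ox A}) : Prop :=
  ComoduleCoalgebra {
    comodule_coassoc :
      (lid H \ot rho) \oL rho = tassoc H H A \oL (DeltaH \ot lid A) \oL rho;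
    comodule_coalgebra_compat :
      (lid H \ot DeltaA) \oL rho =
      mulcomb muH A A \oL (rho \ot rho) \oL DeltaA
  }.

(* [S : series U V] is the power series sum_n (S n) t^n. *)
Definition series {K : fieldType} (U V : lmodType K) := nat -> {linear U -> V}.

Section Series.
Context {K : fieldType}.
Implicit Types U V W X : lmodType K.

Definition sconst U V (f : {linear U -> V}) : series U V :=
  fun n => if n is 0 then f else 0.
Definition scomp U V W (S : series V W) (T : series U V) : series U W :=
  fun n => \sum_(i < n.+1) (S i \oL T (n - i)%N).
Definition stens U U' V V' (S : series U U') (T : series V V') :
    series (U \ox V) (U' \ox V') :=
  fun n => \sum_(i < n.+1) (S i \ot T (n - i)%N).

End Series.

Notation "S \oS T" := (scomp S T)
  (at level 45, left associativity) : ring_scope.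
Notation "S \otS T" := (stens S T)
  (at level 40, left associativity) : ring_scope.

Section SeriesTheory.
Context {K : fieldType}.
Implicit Types U V W X : lmodType K.

Lemma scomp_constl U V W (f : {linear V -> W}) (S : series U V) n :
  (sconst f \oS S) n = f \oL S n.
Proof.
rewrite /scomp big_ord_recl subn0 /= big1 ?addr0 // => i _.
by apply: lin_ext.
Qed.

Lemma scomp_constr U V W (S : series V W) (f : {linear U -> V}) n :
  (S \oS sconst f) n = S n \oL f.
Proof.
rewrite /scomp big_ord_recr subnn /= big1 ?add0r // => i _.
rewrite -[(n - i)%N]prednK ?subn_gt0 ?ltn_ord //=.
by apply: lin_ext => x; rewrite lcompE /= linear0.
Qed.

End SeriesTheory.

Section Deformations.
Context {K : fieldType} {H A : lmodType K}.
Variables (muH : {linear H \ox H -> H}) (DeltaH : {linear H -> H \ox H}).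
Variables (DeltaA : {linear A -> A \ox A}) (rho : {linear A -> H \ox A}).

Record deformation (R : series A (H \ox A)) : Prop := Deformation {
  deformation0 : R 0%N = rho;
  deformation_coassoc :
    (sconst (lid H) \otS R) \oS R =
    sconst (tassoc H H A \oL (DeltaH \ot lid A)) \oS R;
  deformation_compat :
    sconst (lid H \ot DeltaA) \oS R =
    sconst (mulcomb muH A A) \oS (R \otS R) \oS sconst DeltaA
}.

Definition infinitesimal (R : series A (H \ox A)) := R 1%N.

Record formal_automorphism (Phi : series A A) : Prop := FormalAutomorphism {
  formal_automorphism0 : Phi 0%N = lid A;
  formal_automorphism_comul :
    sconst DeltaA \oS Phi = (Phi \otS Phi) \oS sconst DeltaA
}.

Definition sinverse (Phi Psi : series A A) :=
  Psi \oS Phi = sconst (lid A) /\ Phi \oS Psi = sconst (lid A).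

Definition equivalent (R Rbar : series A (H \ox A)) :=
  exists Phi PhiV : series A A,
    [/\ formal_automorphism Phi, sinverse Phi PhiV
      & Rbar = (sconst (lid H) \otS PhiV) \oS R \oS Phi].

Definition rigid := forall R, deformation R -> equivalent R (sconst rho).

End Deformations.

Record cochain (K : fieldType) := Cochain {
  cterm :> nat -> lmodType K;
  cdiff : forall n, {linear cterm n -> cterm n.+1}
}.

Section Cohomology.
Context {K : fieldType} (C : cochain K).

Definition cocycle n (x : C n) := cdiff C n x = 0.

(* There is nothing below degree 0, so only 0 is a coboundary there. *)
Definition coboundary n : C n -> Prop :=
  if n is m.+1 then fun x => exists y : C m, x = cdiff C m y
  else fun x => x = 0.

Definition cohomologous n (x y : C n) := coboundary (x - y).

Definition trivial_cohomology n := forall x : C n, cocycle x -> coboundary x.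

End Cohomology.

(* [tpow H n V] is H^{(x) n} (x) V, bracketed to the right; in particular
   [tpow A n A] is A^{(x) (n + 1)}. *)
Fixpoint tpow {K : fieldType} (H : lmodType K) n (V : lmodType K) : lmodType K :=
  if n is m.+1 then H \ox tpow H m V else V.

Section Coface.
Context {K : fieldType} {H V : lmodType K}.
Variables (Delta : {linear H -> H \ox H}) (rho : {linear V -> H \ox V}).

(* [coface n k] applies [Delta] to the tensor factor of H^{(x) n} (x) V which
   has exactly k factors H on its left, and [rho] to the last factor V when
   k = n (for k > n too, a case never used). *)
Fixpoint coface n k : {linear tpow H n V -> tpow H n.+1 V} :=
  match n, k with
  | 0, _ => rho
  | m.+1, 0 => tassoc H H (tpow H m V) \oL (Delta \ot lid (tpow H m V))
  | m.+1, j.+1 => lid H \ot coface m j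
  end.

End Coface.

(* The identification of A^{(x) (n + 1)} (x) A with A^{(x) (n + 2)}. *)
Fixpoint tpow_rcons {K : fieldType} (A : lmodType K) n :
    {linear tpow A n A \ox A -> tpow A n.+1 A} :=
  if n is m.+1 then (lid A \ot tpow_rcons A m) \oL tassoc A (tpow A m A) A
  else lid (A \ox A).

Section Complexes.
Context {K : fieldType} {H A : lmodType K}.
Variables (muH : {linear H \ox H -> H}) (DeltaH : {linear H -> H \ox H}).
Variables (DeltaA : {linear A -> A \ox A}) (rho : {linear A -> H \ox A}).

Definition coder_pred : {pred {linear A -> A}} := fun phi =>
  `[< DeltaA \oL phi = ((lid A \ot phi) + (phi \ot lid A)) \oL DeltaA >].

Fact coder_submod_closed : submod_closed coder_pred.
Proof.
split=> [|a f g /asboolP cf /asboolP cg]; apply/asboolP.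
  apply: lin_ext => x; rewrite !lcompE linear0.
  have -> : lid A \ot 0 = 0 :> {linear A \ox A -> A \ox A}.
    by apply: tensor_ext => u v; rewrite tmapE -(scale0r 0) tensZr scale0r.
  have -> : 0 \ot lid A = 0 :> {linear A \ox A -> A \ox A}.
    by apply: tensor_ext => u v; rewrite tmapE -(scale0r 0) tensZl scale0r.
  by rewrite addr0.
rewrite lcomp_linr cf cg tmap_linmr tmap_linml addrACA -scalerDr.
by rewrite lcomp_linl.
Qed.
HB.instance Definition _ := GRing.isSubmodClosed.Build K {linear A -> A}
  coder_pred coder_submod_closed.

Record coder := Coder {
  coder_val :> {linear A -> A}; coderP : coder_val \in coder_pred
}.
HB.instance Definition _ := [isSub for coder_val].
HB.instance Definition _ := [Choice of coder by <:].
HB.instance Definition _ := [SubChoice_isSubLmodule of coder by <:].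

Lemma coder_linear : linear coder_val.
Proof. by move=> a f g; rewrite -[coder_val]/(\val) linearP. Qed.

(* d^n_{cc,0}; in term i of the sum Delta_H has n - i factors H on its left *)
Definition dcc0_fun n (phi : {linear A -> tpow H n A}) :
    {linear A -> tpow H n.+1 A} :=
  coface DeltaH rho n n \oL phi
  + \sum_(1 <= i < n.+1) (-1) ^+ i *: (coface DeltaH rho n (n - i) \oL phi)
  + (-1) ^+ n.+1 *: ((lid H \ot phi) \oL rho).

(* d^n_{cc,1} for n = m + 1, so that [tpow A m A] is A^{(x) n} *)
Definition dcc1_fun m (phi : {linear A -> H \ox tpow A m A}) :
    {linear A -> H \ox tpow A m.+1 A} :=
  mulcomb muH A (tpow A m A) \oL (rho \ot phi) \oL DeltaA
  + \sum_(1 <= i < m.+2)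
      (-1) ^+ i *: ((lid H \ot coface DeltaA DeltaA m i.-1) \oL phi)
  + (-1) ^+ m.+2 *: ((lid H \ot tpow_rcons A m)
                     \oL mulcomb muH (tpow A m A) A \oL (phi \ot rho) \oL DeltaA).

(* delta_c on Hom(A, A^{(x) n}) for n = m + 1 *)
Definition delta_fun m (sigma : {linear A -> tpow A m A}) :
    {linear A -> tpow A m.+1 A} :=
  (lid A \ot sigma) \oL DeltaA
  + \sum_(1 <= i < m.+2) (-1) ^+ i *: (coface DeltaA DeltaA m i.-1 \oL sigma)
  + (-1) ^+ m.+2 *: (tpow_rcons A m \oL (sigma \ot lid A) \oL DeltaA).

Fact dcc0_linear n : linear (@dcc0_fun n).
Proof.
apply: lin_funD; first apply: lin_funD.
- exact: lcomp_linr.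
- by apply: lin_fun_sum => i; apply: lin_funZ; exact: lcomp_linr.
- apply: lin_funZ => a f g; by rewrite tmap_linmr lcomp_linl.
Qed.
Definition dcc0 n : {linear {linear A -> tpow H n A} -> _} :=
  mklin (@dcc0_linear n).

Fact dcc1_linear m : linear (@dcc1_fun m).
Proof.
apply: lin_funD; first apply: lin_funD.
- by move=> a f g; rewrite tmap_linmr lcomp_linr lcomp_linl.
- by apply: lin_fun_sum => i; apply: lin_funZ; exact: lcomp_linr.
- by apply: lin_funZ => a f g; rewrite tmap_linml lcomp_linr lcomp_linl.
Qed.
Definition dcc1 m : {linear {linear A -> H \ox tpow A m A} -> _} :=
  mklin (@dcc1_linear m).

Fact delta_linear m : linear (@delta_fun m).
Proof.
apply: lin_funD; first apply: lin_funD.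
- by move=> a f g; rewrite tmap_linmr lcomp_linl.
- by apply: lin_fun_sum => i; apply: lin_funZ; exact: lcomp_linr.
- by apply: lin_funZ => a f g; rewrite tmap_linml lcomp_linr lcomp_linl.
Qed.
Definition delta m : {linear {linear A -> tpow A m A} -> _} :=
  mklin (@delta_linear m).

Definition Fcc_term n : lmodType K :=
  match n with
  | 0 => coder
  | 1 => {linear A -> H \ox A}
  | m.+2 => ({linear A -> tpow H m.+2 A} * {linear A -> H \ox tpow A m.+1 A})%type
  end.

Definition dcc_init_fun (phi : coder) : {linear A -> H \ox A} :=
  rho \oL phi - (lid H \ot phi) \oL rho.
Fact dcc_init_linear : linear dcc_init_fun.
Proof.
move=> a f g; rewrite /dcc_init_fun coder_linear.
rewrite lcomp_linr tmap_linmr lcomp_linl.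
by rewrite scalerBr opprD addrACA.
Qed.

Fact dcc_one_linear :
  linear (fun phi : Fcc_term 1 => (dcc0 1 phi, dcc1 0 phi) : Fcc_term 2).
Proof. by move=> a f g; rewrite !linearP. Qed.

Fact dcc_more_linear m : linear (fun phi : Fcc_term m.+2 =>
  (dcc0 m.+2 phi.1, dcc1 m.+1 phi.2) : Fcc_term m.+3).
Proof. by move=> a f g; rewrite !linearP. Qed.

Definition dcc n : {linear Fcc_term n -> Fcc_term n.+1} :=
  match n with
  | 0 => mklin dcc_init_linear
  | 1 => mklin dcc_one_linear
  | m.+2 => mklin (@dcc_more_linear m)
  end.

Definition Fcc : cochain K := Cochain dcc.

(* 'rV[K]_0 is the zero space. *)
Definition Cc_term n : lmodType K :=
  if n is m.+1 then {linear A -> tpow A m A} else 'rV[K]_0.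

Definition deltac n : {linear Cc_term n -> Cc_term n.+1} :=
  if n is m.+1 then delta m else 0.

Definition Cc : cochain K := Cochain deltac.

End Complexes.

(* Main.v *)
(* To each equation defining a deformation R belongs a defect, the difference of
   its two sides.  Inserting R into the defect in all the ways that occur in the
   differential gives an expression that vanishes identically, because its
   terms cancel by (co)associativity; its lowest coefficient then says that the
   first nonzero coefficient of the defect is a cocycle.  Changing R in degree
   n + 1 changes the defect in degree n + 1 by a coboundary, so that H^2 = 0
   allows R to be built degree by degree.  Formal automorphisms obey the same
   equation as the coalgebra compatibility, with the identity functor in place
   of H (x) -, and their obstructions lie in H^2_c.

   For rigidity one solves R o Phi = (Id (x) Phi) o rho.  The first nonzero
   coefficient, in degree n, of the difference of the two sides is a 1-cocycle,
   hence equal to d^0 phi for a coderivation phi; it is removed by replacing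
   Phi with Phi o Psi, where Psi is an automorphism extending Id - phi t^n.
   These successive Phi agree in more and more degrees, hence converge. *)
Require Import Defs.
From mathcomp Require Import all_boot all_algebra.
From mathcomp Require Import boolp.

Set Implicit Arguments.
Unset Strict Implicit.
Unset Printing Implicit Defensive.

Import GRing.Theory.
Local Open Scope ring_scope.

(** * Cauchy products and power series of linear maps *)

Section AbelianGroups.
Context {V : zmodType}.

(** Each letter occurs once with each sign. In this pattern, or in that of [cancel_sum4C], the four
    terms of the differential of a defect cancel. *)
Lemma cancel_sum4 (a b c d : V) : (a - b) - (c - d) + (c - a) - (d - b) = 0.
Proof.
by rewrite !opprB [a - b + _]addrC -addrA addrACA !subrKA subrr.
Qed.

Lemma cancel_sum4C (a b c d : V) : (a - b) - (c - d) + (b - d) - (a - c) = 0.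
Proof. by rewrite !opprB addrAC -[d - c]opprB -[b - d]opprB cancel_sum4. Qed.

(** Both sides run over the triples of sum [n]: the left one groups the first two entries, the right
    one the last two. *)
Lemma big_ord_triangle (F : nat -> nat -> nat -> V) n :
  \sum_(i < n.+1) \sum_(j < i.+1) F j (i - j)%N (n - i)%N =
  \sum_(j < n.+1) \sum_(k < (n - j).+1) F j k (n - j - k)%N.
Proof.
rewrite (eq_bigr (fun i : 'I_n.+1 =>
  \sum_(j < n.+1 | (j <= i)%N) F j (i - j)%N (n - i)%N)); last first.
  move=> i _.
  by rewrite (big_ord_widen _ (fun j => F j (i - j)%N (n - i)%N) (ltn_ord i)).
rewrite (exchange_big_dep predT) //=; apply: eq_bigr => j _.
rewrite -(big_mkord (fun i => j <= i)%N (fun i => F j (i - j)%N (n - i)%N)).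
rewrite (big_cat_nat (n := j)) //=; last exact: ltnW.
rewrite big_nat_cond big1 ?add0r; last first.
  by move=> i /andP[/andP[_ ij]]; rewrite leqNgt ij.
rewrite big_nat_cond (eq_bigl (fun i => j <= i < n.+1)%N); last first.
  by move=> i; rewrite andbAC andbb.
rewrite -big_nat -{1}[j : nat]add0n big_addn big_mkord subSn -1?ltnS //.
by apply: eq_bigr => k _; rewrite addnK subnDA subnAC.
Qed.

End AbelianGroups.

Section Convolution.
Context {K : fieldType}.
Implicit Types U V W X UV VW : lmodType K.

(* Associativity of the Cauchy product: both sides of an associativity or
   naturality law of bilinear maps extend to power series. *)
Lemma convolutionA U V W UV VW X
    (p : U -> V -> UV) (f : UV -> W -> X) (q : V -> W -> VW) (g : U -> VW -> X)
    (S : nat -> U) (T : nat -> V) (R : nat -> W) n :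
  (forall w, linear (f^~ w)) -> (forall u, linear (g u)) ->
  (forall u v w, f (p u v) w = g u (q v w)) ->
  \sum_(i < n.+1) f (\sum_(j < i.+1) p (S j) (T (i - j)%N)) (R (n - i)%N) =
  \sum_(i < n.+1) g (S i) (\sum_(j < (n - i).+1) q (T j) (R (n - i - j)%N)).
Proof.
move=> fl gl fg.
transitivity (\sum_(i < n.+1) \sum_(j < i.+1)
    f (p (S j) (T (i - j)%N)) (R (n - i)%N)).
  by apply: eq_bigr => i _; exact: (linear_sum (mklin (fl _))).
rewrite (big_ord_triangle (fun j k l => f (p (S j) (T k)) (R l))).
apply: eq_bigr => i _; under eq_bigr do rewrite fg.
by symmetry; exact: (linear_sum (mklin (gl _))).
Qed.

(** Only the summand [i = n] survives. This and its mirror image extract the lowest coefficient of a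
    product. *)
Lemma convolution_leadl U V X (b : U -> V -> X) (S : nat -> U) (T : nat -> V)
    n :
  (forall v, linear (b^~ v)) -> (forall k, (k < n)%N -> S k = 0) ->
  \sum_(i < n.+1) b (S i) (T (n - i)%N) = b (S n) (T 0%N).
Proof.
move=> bl S0; rewrite big_ord_recr /= subnn big1 ?add0r // => i _.
by rewrite S0 //; exact: (linear0 (mklin (bl _))).
Qed.

Lemma convolution_leadr U V X (b : U -> V -> X) (S : nat -> U) (T : nat -> V)
    n :
  (forall u, linear (b u)) -> (forall k, (k < n)%N -> T k = 0) ->
  \sum_(i < n.+1) b (S i) (T (n - i)%N) = b (S 0%N) (T n).
Proof.
move=> br T0; rewrite big_ord_recl /= subn0 big1 ?addr0 // => i _.
rewrite T0; first exact: (linear0 (mklin (br _))).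
by rewrite /bump add1n ltn_subrL (leq_ltn_trans _ (ltn_ord i)).
Qed.

(** A product rule for the lowest change: coefficients of degree [n.+1] enter only the two end
    summands, where they meet coefficients of degree 0; the summands in between cancel. *)
Lemma convolution_perturb U V X (b : U -> V -> X) (S S' : nat -> U)
    (T T' : nat -> V) n :
  (forall v, linear (b^~ v)) -> (forall u, linear (b u)) ->
  (forall k, (k <= n)%N -> S' k = S k) ->
  (forall k, (k <= n)%N -> T' k = T k) ->
  \sum_(i < n.+2) b (S' i) (T' (n.+1 - i)%N) -
    \sum_(i < n.+2) b (S i) (T (n.+1 - i)%N) =
  b (S 0%N) (T' n.+1 - T n.+1) + b (S' n.+1 - S n.+1) (T 0%N).
Proof.
move=> bl br eS eT.
have bBr (u : U) (v v' : V) : b u (v - v') = b u v - b u v' :=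
    linearB (mklin (br u)) v v'.
have bBl (v : V) (u u' : U) : b (u - u') v = b u v - b u' v :=
    linearB (mklin (bl v)) u u'.
have peel (F : nat -> X) :
    \sum_(i < n.+2) F i = \sum_(i < n) F i.+1 + (F 0%N + F n.+1).
  by rewrite big_ord_recr big_ord_recl /= addrAC addrC addrA.
rewrite (peel (fun i => b (S' i) (T' (n.+1 - i)%N))).
rewrite (peel (fun i => b (S i) (T (n.+1 - i)%N))) !subn0.
rewrite !subnn (eS 0%N) // (eT 0%N) // bBr bBl.
rewrite (eq_bigr (fun i : 'I_n => b (S i.+1) (T (n.+1 - i.+1)%N))).
  by rewrite opprD addrACA subrr add0r opprD addrACA.
by move=> i _; rewrite subSS eS ?eT // leq_subr.
Qed.

End Convolution.

(** * Composites and tensor products of linear maps *)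

Section LinearMaps.
Context {K : fieldType}.
Implicit Types T U V W X Y Z : lmodType K.

Lemma lidE U (x : U) : lid U x = x. Proof. by []. Qed.

Lemma lcompA U V W X (h : {linear W -> X}) (g : {linear V -> W})
    (f : {linear U -> V}) : h \oL (g \oL f) = h \oL g \oL f.
Proof. exact: lin_ext. Qed.

Lemma lcomp1l U V (f : {linear U -> V}) : lid V \oL f = f.
Proof. exact: lin_ext. Qed.

Lemma lcomp1r U V (f : {linear U -> V}) : f \oL lid U = f.
Proof. exact: lin_ext. Qed.

Lemma lcomp0r U V W (g : {linear V -> W}) : g \oL (0 : {linear U -> V}) = 0.
Proof. by apply: lin_ext => x; rewrite lcompE linear0. Qed.

Lemma lcompDl U V W (g h : {linear V -> W}) (f : {linear U -> V}) :
  (g + h) \oL f = g \oL f + h \oL f.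
Proof. exact: lin_ext. Qed.

Lemma lcompDr U V W (h : {linear V -> W}) (f g : {linear U -> V}) :
  h \oL (f + g) = h \oL f + h \oL g.
Proof. by apply: lin_ext => x; rewrite lcompE linearD. Qed.

Lemma lcompBl U V W (g h : {linear V -> W}) (f : {linear U -> V}) :
  (g - h) \oL f = g \oL f - h \oL f.
Proof. exact: lin_ext. Qed.

Lemma lcompBr U V W (h : {linear V -> W}) (f g : {linear U -> V}) :
  h \oL (f - g) = h \oL f - h \oL g.
Proof. by apply: lin_ext => x; rewrite lcompE linearB. Qed.

Lemma lcompNr U V W (h : {linear V -> W}) (f : {linear U -> V}) :
  h \oL (- f) = - (h \oL f).
Proof. by apply: lin_ext => x; rewrite lcompE linearN. Qed.

Lemma lcompNl U V W (h : {linear V -> W}) (f : {linear U -> V}) :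
  (- h) \oL f = - (h \oL f).
Proof. exact: lin_ext. Qed.

Lemma tmap_comp U U' U'' V V' V'' (f : {linear U' -> U''})
    (g : {linear V' -> V''}) (f' : {linear U -> U'}) (g' : {linear V -> V'}) :
  (f \ot g) \oL (f' \ot g') = (f \oL f') \ot (g \oL g').
Proof. by apply: tensor_ext => u v; rewrite lcompE !tmapE. Qed.

Lemma tmap1 U V : lid U \ot lid V = lid (U \ox V).
Proof. by apply: tensor_ext => u v; rewrite tmapE. Qed.

Lemma tmap0l U U' V V' (g : {linear V -> V'}) :
  (0 : {linear U -> U'}) \ot g = 0.
Proof. exact: (linear0 (mklin (@tmap_linml K U U' V V' g))). Qed.

Lemma tmap0r U U' V V' (f : {linear U -> U'}) :
  f \ot (0 : {linear V -> V'}) = 0.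
Proof. exact: (linear0 (mklin (@tmap_linmr K U U' V V' f))). Qed.

Lemma tmapNr U U' V V' (f : {linear U -> U'}) (g : {linear V -> V'}) :
  f \ot (- g) = - (f \ot g).
Proof. exact: (linearN (mklin (@tmap_linmr K U U' V V' f))). Qed.

Lemma tmapBl U U' V V' (f f' : {linear U -> U'}) (g : {linear V -> V'}) :
  (f - f') \ot g = f \ot g - f' \ot g.
Proof. exact: (linearB (mklin (@tmap_linml K U U' V V' g))). Qed.

Lemma tmapBr U U' V V' (f : {linear U -> U'}) (g g' : {linear V -> V'}) :
  f \ot (g - g') = f \ot g - f \ot g'.
Proof. exact: (linearB (mklin (@tmap_linmr K U U' V V' f))). Qed.

(** Currying: with [w] fixed, both maps become linear on [U \ox V], where [tensor_ext] applies. The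
    further extensionality lemmas iterate this. *)
Lemma tensor_ext_l3 U V W X (f g : {linear (U \ox V) \ox W -> X}) :
  (forall u v w, f (tens (tens u v) w) = g (tens (tens u v) w)) -> f = g.
Proof.
move=> fg; apply: tensor_ext => x w.
have/(congr1 (fun h : {linear _ -> _} => h x)) // :
  f \oL mklin (@tens_linl K (U \ox V) W w) = g \oL mklin (tens_linl w).
by apply: tensor_ext => u v; exact: fg.
Qed.

Lemma tensor_ext4 U V W X Y (f g : {linear (U \ox V) \ox (W \ox X) -> Y}) :
  (forall u v w x, f (tens (tens u v) (tens w x)) =
                   g (tens (tens u v) (tens w x))) -> f = g.
Proof.
move=> fg; apply: tensor_ext_l3 => u v y.
have/(congr1 (fun h : {linear _ -> _} => h y)) // :
  f \oL mklin (@tens_linr K (U \ox V) (W \ox X) (tens u v)) =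
  g \oL mklin (tens_linr (tens u v)).
by apply: tensor_ext => w x; exact: fg.
Qed.

Lemma tensor_ext6 U V W X Y Z T
    (f g : {linear ((U \ox V) \ox (W \ox X)) \ox (Y \ox Z) -> T}) :
  (forall u v w x y z, f (tens (tens (tens u v) (tens w x)) (tens y z)) =
                       g (tens (tens (tens u v) (tens w x)) (tens y z))) ->
  f = g.
Proof.
move=> fg; apply: tensor_ext => a b.
have/(congr1 (fun h : {linear _ -> _} => h a)) // :
  f \oL mklin (@tens_linl K ((U \ox V) \ox (W \ox X)) (Y \ox Z) b) =
  g \oL mklin (tens_linl b).
apply: tensor_ext4 => u v w x.
have/(congr1 (fun h : {linear _ -> _} => h b)) // :
  f \oL mklin (@tens_linr K ((U \ox V) \ox (W \ox X)) (Y \ox Z)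
                 (tens (tens u v) (tens w x))) =
  g \oL mklin (tens_linr (tens (tens u v) (tens w x))).
by apply: tensor_ext => y z; exact: fg.
Qed.

Lemma tensor_ext_l4 U V W X Y (f g : {linear ((U \ox V) \ox W) \ox X -> Y}) :
  (forall u v w x, f (tens (tens (tens u v) w) x) =
                   g (tens (tens (tens u v) w) x)) -> f = g.
Proof.
move=> fg; apply: tensor_ext => y x.
have/(congr1 (fun h : {linear _ -> _} => h y)) // :
  f \oL mklin (@tens_linl K ((U \ox V) \ox W) X x) = g \oL mklin (tens_linl x).
by apply: tensor_ext_l3 => u v w; exact: fg.
Qed.

Lemma tassoc_pentagon U V W X :
  (lid U \ot tassoc V W X) \oL tassoc U (V \ox W) X
    \oL (tassoc U V W \ot lid X) =
  tassoc U V (W \ox X) \oL tassoc (U \ox V) W X.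
Proof.
by apply: tensor_ext_l4 => u v w x; rewrite !lcompE !(tmapE, tassocE).
Qed.

Lemma tassoc_natural U U' V V' W W' (f : {linear U -> U'})
    (g : {linear V -> V'}) (h : {linear W -> W'}) :
  tassoc U' V' W' \oL ((f \ot g) \ot h) = (f \ot (g \ot h)) \oL tassoc U V W.
Proof.
by apply: tensor_ext_l3 => u v w; rewrite !lcompE !tassocE !tmapE tassocE.
Qed.

End LinearMaps.

(** * Composition and tensor product of power series *)

Section SeriesAlgebra.
Context {K : fieldType}.
Implicit Types U V W X : lmodType K.

Lemma scompA U V W X (S : series W X) (T : series V W) (R : series U V) :
  S \oS (T \oS R) = S \oS T \oS R.
Proof.
apply: funext => n; symmetry.
apply: (convolutionA (f := @lcomp K U V X) (g := @lcomp K U W X)).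
- by move=> h; exact: lcomp_linl.
- by move=> h; exact: lcomp_linr.
- by move=> h g f; rewrite lcompA.
Qed.

Lemma scomp1l U V (S : series U V) : sconst (lid V) \oS S = S.
Proof. by apply: funext => n; rewrite scomp_constl lcomp1l. Qed.

Lemma scomp1r U V (S : series U V) : S \oS sconst (lid U) = S.
Proof. by apply: funext => n; rewrite scomp_constr lcomp1r. Qed.

Lemma sconst_comp U V W (g : {linear V -> W}) (f : {linear U -> V}) :
  sconst g \oS sconst f = sconst (g \oL f).
Proof.
by apply: funext => -[|n]; rewrite scomp_constl //= lcomp0r.
Qed.

Lemma stens_constl U U' V V' (f : {linear U -> U'}) (S : series V V') n :
  (sconst f \otS S) n = f \ot S n.
Proof.
rewrite /stens big_ord_recl subn0 big1 ?addr0 //= => i _; exact: tmap0l.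
Qed.

Lemma stens_constr U U' V V' (S : series U U') (g : {linear V -> V'}) n :
  (S \otS sconst g) n = S n \ot g.
Proof.
rewrite /stens big_ord_recr subnn /= big1 ?add0r // => i _.
by rewrite -[(n - i)%N]prednK ?subn_gt0 ?ltn_ord //= tmap0r.
Qed.

Lemma stens_const U U' V V' (f : {linear U -> U'}) (g : {linear V -> V'}) :
  sconst f \otS sconst g = sconst (f \ot g).
Proof. by apply: funext => -[|n]; rewrite stens_constl //= tmap0r. Qed.

Lemma stens1l_comp U V V' V'' (S : series V' V'') (T : series V V') :
  sconst (lid U) \otS (S \oS T) =
  (sconst (lid U) \otS S) \oS (sconst (lid U) \otS T).
Proof.
apply: funext => n; rewrite stens_constl.
rewrite [LHS](linear_sum (mklin (@tmap_linmr K U U V V'' (lid U)))).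
by apply: eq_bigr => i _; rewrite !stens_constl tmap_comp lcomp1l.
Qed.

Lemma stens1r_comp U V V' V'' (S : series V' V'') (T : series V V') :
  (S \oS T) \otS sconst (lid U) =
  (S \otS sconst (lid U)) \oS (T \otS sconst (lid U)).
Proof.
apply: funext => n; rewrite stens_constr.
rewrite [LHS](linear_sum (mklin (@tmap_linml K V V'' U U (lid U)))).
by apply: eq_bigr => i _; rewrite !stens_constr tmap_comp lcomp1l.
Qed.

Lemma stens_split U U' V V' (S : series U U') (T : series V V') :
  S \otS T = (S \otS sconst (lid V')) \oS (sconst (lid U) \otS T).
Proof.
apply: funext => n; apply: eq_bigr => i _.
by rewrite stens_constl stens_constr tmap_comp lcomp1l lcomp1r.
Qed.

Lemma stens_splitC U U' V V' (S : series U U') (T : series V V') :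
  S \otS T = (sconst (lid U') \otS T) \oS (S \otS sconst (lid V)).
Proof.
apply: funext => n; rewrite [LHS](reindex_inj rev_ord_inj) /=.
apply: eq_bigr => i _; rewrite subSS subKn -1?ltnS //.
by rewrite stens_constl stens_constr tmap_comp lcomp1l lcomp1r.
Qed.

(** No multiple sum is rearranged: both tensor products are split, and the two middle factors, which
    act on different sides, commute by [stens_split] and [stens_splitC]. *)
Lemma stens_comp U U' U'' V V' V'' (S : series U' U'') (T : series V' V'')
    (S' : series U U') (T' : series V V') :
  (S \otS T) \oS (S' \otS T') = (S \oS S') \otS (T \oS T').
Proof.
rewrite [S \otS T]stens_split [S' \otS T']stens_split scompA.
rewrite -[_ \oS _ \oS (S' \otS _)]scompA -stens_splitC [S' \otS T]stens_split.
by rewrite scompA -stens1r_comp -scompA -stens1l_comp -stens_split.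
Qed.

Lemma sconst_tassoc_natural U U' V V' W W' (S : series U U')
    (T : series V V') (R : series W W') :
  sconst (tassoc U' V' W') \oS ((S \otS T) \otS R) =
  (S \otS (T \otS R)) \oS sconst (tassoc U V W).
Proof.
apply: funext => n; rewrite scomp_constl scomp_constr.
rewrite [LHS](linear_sum (mklin (@lcomp_linr K _ _ _ (tassoc U' V' W')))).
rewrite [RHS](linear_sum (mklin (@lcomp_linl K _ _ _ (tassoc U V W)))).
(* The associator is absorbed into the two outer bilinear maps of [convolutionA]. *)
apply: (convolutionA (f := fun x h => tassoc U' V' W' \oL (x \ot h))
  (g := fun f y => (f \ot y) \oL tassoc U V W)) => [h|f|f g h].
- by move=> a x y; rewrite tmap_linml lcomp_linr.
- by move=> a x y; rewrite tmap_linmr lcomp_linl.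
- exact: tassoc_natural.
Qed.

Definition sdiff U V (S T : series U V) : series U V := fun n => S n - T n.

Lemma sdiff_eq U V (S T : series U V) :
  (forall n, sdiff S T n = 0) <-> S = T.
Proof.
split=> [ST|-> n]; last exact: subrr.
by apply: funext => n; apply/eqP; rewrite -subr_eq0; apply/eqP; exact: ST.
Qed.

Lemma scompBl U V W (S S' : series V W) (T : series U V) :
  sdiff S S' \oS T = sdiff (S \oS T) (S' \oS T).
Proof.
apply: funext => n; rewrite /sdiff /scomp -sumrB.
by apply: eq_bigr => i _; rewrite lcompBl.
Qed.

Lemma scompBr U V W (S : series V W) (T T' : series U V) :
  S \oS sdiff T T' = sdiff (S \oS T) (S \oS T').
Proof.
apply: funext => n; rewrite /sdiff /scomp -sumrB.
by apply: eq_bigr => i _; rewrite lcompBr.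
Qed.

Lemma stensBl U U' V V' (S S' : series U U') (T : series V V') :
  sdiff S S' \otS T = sdiff (S \otS T) (S' \otS T).
Proof.
apply: funext => n; rewrite /sdiff /stens -sumrB.
by apply: eq_bigr => i _; rewrite tmapBl.
Qed.

Lemma stensBr U U' V V' (S : series U U') (T T' : series V V') :
  S \otS sdiff T T' = sdiff (S \otS T) (S \otS T').
Proof.
apply: funext => n; rewrite /sdiff /stens -sumrB.
by apply: eq_bigr => i _; rewrite tmapBr.
Qed.

Lemma eq_scomp U V W (S S' : series V W) (T T' : series U V) n :
  (forall k, (k <= n)%N -> S k = S' k) ->
  (forall k, (k <= n)%N -> T k = T' k) -> (S \oS T) n = (S' \oS T') n.
Proof.
move=> eS eT; apply: eq_bigr => i _.
by rewrite eS -1?ltnS // eT // leq_subr.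
Qed.

Lemma eq_stens U U' V V' (S S' : series U U') (T T' : series V V') n :
  (forall k, (k <= n)%N -> S k = S' k) ->
  (forall k, (k <= n)%N -> T k = T' k) -> (S \otS T) n = (S' \otS T') n.
Proof.
move=> eS eT; apply: eq_bigr => i _.
by rewrite eS -1?ltnS // eT // leq_subr.
Qed.

Lemma scomp_leadl U V W (S : series V W) (T : series U V) n :
  (forall k, (k < n)%N -> S k = 0) -> (S \oS T) n = S n \oL T 0%N.
Proof. by apply: convolution_leadl => v; exact: lcomp_linl. Qed.

Lemma scomp_leadr U V W (S : series V W) (T : series U V) n :
  (forall k, (k < n)%N -> T k = 0) -> (S \oS T) n = S 0%N \oL T n.
Proof. by apply: convolution_leadr => v; exact: lcomp_linr. Qed.

Lemma stens_leadl U U' V V' (S : series U U') (T : series V V') n :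
  (forall k, (k < n)%N -> S k = 0) -> (S \otS T) n = S n \ot T 0%N.
Proof. by apply: convolution_leadl => v; exact: tmap_linml. Qed.

Lemma stens_leadr U U' V V' (S : series U U') (T : series V V') n :
  (forall k, (k < n)%N -> T k = 0) -> (S \otS T) n = S 0%N \ot T n.
Proof. by apply: convolution_leadr => v; exact: tmap_linmr. Qed.

Lemma scomp_perturb U V W (S S' : series V W) (T T' : series U V) n :
  (forall k, (k <= n)%N -> S' k = S k) ->
  (forall k, (k <= n)%N -> T' k = T k) ->
  (S' \oS T') n.+1 - (S \oS T) n.+1 =
  S 0%N \oL (T' n.+1 - T n.+1) + (S' n.+1 - S n.+1) \oL T 0%N.
Proof.
apply: (convolution_perturb (b := @lcomp K U V W)) => f.
- exact: lcomp_linl.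
- exact: lcomp_linr.
Qed.

Lemma stens_perturb U U' V V' (S S' : series U U') (T T' : series V V') n :
  (forall k, (k <= n)%N -> S' k = S k) ->
  (forall k, (k <= n)%N -> T' k = T k) ->
  (S' \otS T') n.+1 - (S \otS T) n.+1 =
  S 0%N \ot (T' n.+1 - T n.+1) + (S' n.+1 - S n.+1) \ot T 0%N.
Proof.
apply: (convolution_perturb (b := @tmap K U U' V V')) => f.
- exact: tmap_linml.
- exact: tmap_linmr.
Qed.

End SeriesAlgebra.

(** * Convolution products *)

(* [G] stands for H (x) - (comodule-coalgebra deformations) and for the
   identity functor (formal automorphisms): in both cases the equation studied
   is  G(Delta) o R = R * R  for the convolution product [conv]. *)
Section ConvolutionProduct.
Context {K : fieldType} {A : lmodType K} (DeltaA : {linear A -> A \ox A}).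
Context {G : lmodType K -> lmodType K}.
Context (gmap : forall U V : lmodType K,
  {linear U -> V} -> {linear G U -> G V}).
Context (gmul : forall U V : lmodType K, {linear G U \ox G V -> G (U \ox V)}).
Arguments gmap {U V}.
Implicit Types U V W : lmodType K.

Hypothesis coassocA : coassociative DeltaA.
Hypothesis gmap1 : forall U, gmap (lid U) = lid (G U).
Hypothesis gmap_comp : forall U V W (g : {linear V -> W}) (f : {linear U -> V}),
  gmap (g \oL f) = gmap g \oL gmap f.
Hypothesis gmul_natural :
  forall U U' V V' (f : {linear U -> U'}) (g : {linear V -> V'}),
  gmul U' V' \oL (gmap f \ot gmap g) = gmap (f \ot g) \oL gmul U V.
Hypothesis gmulA : forall U V W,
  gmap (tassoc U V W) \oL gmul (U \ox V) W \oL (gmul U V \ot lid (G W)) =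
  gmul U (V \ox W) \oL (lid (G U) \ot gmul V W) \oL tassoc (G U) (G V) (G W).

(** Under the hypotheses above, [gmap] and [gmul] make [G] a lax monoidal functor, units aside; this
    is the convolution product of series from the coalgebra [A] to values of [G]. *)
Definition conv U V (S : series A (G U)) (T : series A (G V)) :
    series A (G (U \ox V)) :=
  sconst (gmul U V) \oS (S \otS T) \oS sconst DeltaA.

Lemma convE U V (S : series A (G U)) (T : series A (G V)) n :
  conv S T n = gmul U V \oL (S \otS T) n \oL DeltaA.
Proof. by rewrite /conv scomp_constr scomp_constl. Qed.

Lemma conv_natural U U' V V' (f : {linear U -> U'}) (g : {linear V -> V'})
    (S : series A (G U)) (T : series A (G V)) :
  conv (sconst (gmap f) \oS S) (sconst (gmap g) \oS T) =
  sconst (gmap (f \ot g)) \oS conv S T.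
Proof.
rewrite /conv -stens_comp stens_const !scompA !sconst_comp.
by rewrite gmul_natural.
Qed.

(** Constants are pulled out of the tensor products; then [gmulA], naturality of the associator and
    coassociativity of [DeltaA] turn one bracketing into the other. *)
Lemma convA U V W (S : series A (G U)) (T : series A (G V))
    (R : series A (G W)) :
  sconst (gmap (tassoc U V W)) \oS conv (conv S T) R = conv S (conv T R).
Proof.
have eL : conv S T \otS R =
    (sconst (gmul U V) \otS sconst (lid (G W))) \oS ((S \otS T) \otS R)
    \oS (sconst DeltaA \otS sconst (lid A)).
  by rewrite !stens_comp scomp1l scomp1r.
have eR : S \otS conv T R =
    (sconst (lid (G U)) \otS sconst (gmul V W)) \oS (S \otS (T \otS R))
    \oS (sconst (lid A) \otS sconst DeltaA).
  by rewrite !stens_comp scomp1l scomp1r.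
rewrite [in LHS]/conv eL [in RHS]/conv eR !stens_const !scompA !sconst_comp.
rewrite gmulA -[sconst (_ \oL tassoc _ _ _)]sconst_comp.
rewrite -[_ \oS sconst (tassoc _ _ _) \oS _]scompA sconst_tassoc_natural.
rewrite !scompA -!(scompA _ (sconst _) (sconst _)) !sconst_comp coassocA.
by rewrite -lcompA -[in RHS](sconst_comp (tassoc _ _ _)) scompA.
Qed.

Lemma convBl U V (S S' : series A (G U)) (T : series A (G V)) :
  conv (sdiff S S') T = sdiff (conv S T) (conv S' T).
Proof. by rewrite /conv stensBl scompBr scompBl. Qed.

Lemma convBr U V (S : series A (G U)) (T T' : series A (G V)) :
  conv S (sdiff T T') = sdiff (conv S T) (conv S T').
Proof. by rewrite /conv stensBr scompBr scompBl. Qed.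

Definition comul_defect (R : series A (G A)) : series A (G (A \ox A)) :=
  sdiff (sconst (gmap DeltaA) \oS R) (conv R R).

(** Up to sign, the linear part of the defect at [r]. It becomes [dcc1] for [H \ox -] with
    [r = rho], and [delta] for the identity functor with [r = lid A]; [comul_d2] becomes the next
    differential. *)
Definition comul_d1 (r phi : {linear A -> G A}) : {linear A -> G (A \ox A)} :=
  gmul A A \oL (r \ot phi + phi \ot r) \oL DeltaA - gmap DeltaA \oL phi.

Definition comul_d2 (r : {linear A -> G A}) (phi : {linear A -> G (A \ox A)}) :
    {linear A -> G (A \ox (A \ox A))} :=
  gmul A (A \ox A) \oL (r \ot phi) \oL DeltaA
  - gmap (tassoc A A A \oL (DeltaA \ot lid A)) \oL phi
  + gmap (lid A \ot DeltaA) \oL phi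
  - gmap (tassoc A A A) \oL gmul (A \ox A) A \oL (phi \ot r) \oL DeltaA.

(** Each of the four terms of [comul_d2] is the coefficient in degree [n] of a difference of two
    series, and only four different series occur in all. *)
Lemma comul_defect_cocycle (R : series A (G A)) n :
  (forall k, (k < n)%N -> comul_defect R k = 0) ->
  comul_d2 (R 0%N) (comul_defect R n) = 0.
Proof.
move=> E0; set E := comul_defect R in E0 *.
pose T := sconst (gmap DeltaA) \oS R.
have RT : conv R T = sconst (gmap (lid A \ot DeltaA)) \oS conv R R.
  by rewrite -conv_natural gmap1 scomp1l.
have TR : conv T R = sconst (gmap (DeltaA \ot lid A)) \oS conv R R.
  by rewrite -conv_natural gmap1 scomp1l.
transitivity ((conv R T n - conv R (conv R R) n)
  - ((sconst (gmap (tassoc A A A \oL (DeltaA \ot lid A))) \oS T) n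
     - (sconst (gmap (tassoc A A A \oL (DeltaA \ot lid A))) \oS conv R R) n)
  + ((sconst (gmap (lid A \ot DeltaA)) \oS T) n - conv R T n)
  - ((sconst (gmap (tassoc A A A \oL (DeltaA \ot lid A))) \oS conv R R) n
     - conv R (conv R R) n)).
  (* As the defect vanishes below degree [n], only [R 0%N] meets its coefficient of degree [n] in a
     product. *)
  congr (_ - _ + _ - _).
  - rewrite -/(sdiff _ _ n) -convBr convE stens_leadr //.
  - by rewrite -/(sdiff _ _ n) -scompBr scomp_constl.
  - by rewrite RT -/(sdiff _ _ n) -scompBr scomp_constl.
  - rewrite gmap_comp -sconst_comp -scompA -TR -convA.
    rewrite -/(sdiff _ _ n) -scompBr -convBl scomp_constl convE stens_leadl //.
    by rewrite !lcompA.
(* Coassociativity of [DeltaA] identifies two of the five series left. *)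
have -> : sconst (gmap (tassoc A A A \oL (DeltaA \ot lid A))) \oS T =
    sconst (gmap (lid A \ot DeltaA)) \oS T.
  by rewrite /T !scompA !sconst_comp -!gmap_comp coassocA.
by rewrite cancel_sum4.
Qed.

(** The minus sign arises because [conv R R] enters the defect negatively, while the products in
    [comul_d1] are positive. *)
Lemma comul_defect_perturb (R R' : series A (G A)) n :
  (forall k, (k <= n)%N -> R' k = R k) ->
  comul_defect R' n.+1 - comul_defect R n.+1 =
  - comul_d1 (R 0%N) (R' n.+1 - R n.+1).
Proof.
move=> eR; rewrite /comul_defect /sdiff !convE !scomp_constl opprD addrACA.
rewrite -lcompBr -opprD -!lcompBl -!lcompBr stens_perturb // /comul_d1.
by rewrite opprB.
Qed.

Lemma comul_defect_local (R R' : series A (G A)) n :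
  (forall k, (k <= n)%N -> R' k = R k) ->
  comul_defect R' n = comul_defect R n.
Proof.
move=> eR; rewrite /comul_defect /sdiff !convE !scomp_constl eR //.
by congr (_ - _ \oL _ \oL _); exact: eq_stens.
Qed.

End ConvolutionProduct.

(* Each step may change the coefficients above the current degree only, so the
   successive approximations have a coefficientwise limit. *)
Lemma stepwise_limit (T : Type) (P : nat -> (nat -> T) -> Prop) N
    (S0 : nat -> T) :
  (forall n S S', (forall k, (k <= n)%N -> S' k = S k) -> P n S -> P n S') ->
  (forall k, (k <= N)%N -> P k S0) ->
  (forall n S, (N <= n)%N -> (forall k, (k <= n)%N -> P k S) ->
    exists S', (forall k, (k <= n)%N -> S' k = S k) /\ P n.+1 S') ->
  exists S, (forall k, (k <= N)%N -> S k = S0 k) /\ forall n, P n S.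
Proof.
move=> Ploc P0 step.
(* The premises of [step] are moved under the existential, so that choice gives a function on all
   pairs of a degree and a series; where they fail, the series itself is the default value. *)
have /choice[f fP] (x : nat * (nat -> T)) : exists S',
    (N <= x.1)%N -> (forall k, (k <= x.1)%N -> P k x.2) ->
    (forall k, (k <= x.1)%N -> S' k = x.2 k) /\ P x.1.+1 S'.
  case: x => n S /=.
  have [Nn|] := boolP (N <= n)%N; last by exists S.
  have [PS|nPS] := pselect (forall k, (k <= n)%N -> P k S); last by exists S.
  by have [S' S'P] := step n S Nn PS; exists S'.
(* The approximation [s i] satisfies [P] through degree [N + i]. *)
pose s := nat_rect (fun=> nat -> T) S0 (fun i S => f ((N + i)%N, S)).
have Ps i k : (k <= N + i)%N -> P k (s i).
  elim: i k => [|i IHi] k; first by rewrite addn0; exact: P0.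
  have [fE fS] := fP ((N + i)%N, s i) (leq_addr _ _) IHi.
  rewrite addnS leq_eqVlt => /predU1P[->|] //; rewrite ltnS => ki.
  by apply: Ploc (IHi k ki) => j jk; exact: fE (leq_trans jk ki).
have sE i j k : (k <= N + i)%N -> s (i + j)%N k = s i k.
  move=> ki; elim: j => [|j IHj]; first by rewrite addn0.
  rewrite -IHj addnS.
  have [fE _] := fP ((N + (i + j))%N, s (i + j)%N) (leq_addr _ _) (Ps _).
  by apply: fE; rewrite /= addnA; exact: leq_trans ki (leq_addr _ _).
(* The diagonal is the limit: by [sE], coefficient [k] no longer changes from [s k] on. *)
exists (fun k => s k k); split=> [k kN|n].
  by rewrite -[X in s X]add0n sE ?addn0.
apply: (Ploc n (s n)) => [k kn|]; last by apply: Ps; exact: leq_addl.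
by rewrite -(subnKC kn) sE // leq_addl.
Qed.

(** * Inverses of power series under composition *)

Section SeriesInverse.
Context {K : fieldType}.
Implicit Types U V : lmodType K.

Definition set_coef U V n (f : {linear U -> V}) (S : series U V) : series U V :=
  fun k => if k == n then f else S k.

Lemma set_coef_at U V n (f : {linear U -> V}) (S : series U V) :
  set_coef n f S n = f.
Proof. by rewrite /set_coef eqxx. Qed.

Lemma set_coef_below U V n (f : {linear U -> V}) (S : series U V) k :
  (k <= n)%N -> set_coef n.+1 f S k = S k.
Proof. by move=> kn; rewrite /set_coef ltn_eqF. Qed.

Lemma series_left_inverse U (Phi : series U U) :
  Phi 0%N = lid U -> exists Psi, Psi \oS Phi = sconst (lid U).
Proof.
move=> Phi0.
have [||n S _ _|Psi [_ PsiP]] := @stepwise_limit _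
    (fun n (Psi : series U U) => (Psi \oS Phi) n = sconst (lid U) n)
    0%N (sconst (lid U)).
- by move=> n S S' eS <-; exact: eq_scomp.
- by case=> // _; rewrite scomp_constl Phi0 lcomp1l.
(* Since [Phi 0%N] is the identity, a change of [S n.+1] changes the composite in degree [n.+1] by
   the same amount; the target coefficient there is 0. *)
- exists (set_coef n.+1 (S n.+1 - (S \oS Phi) n.+1) S); split=> [k kn|].
    by rewrite set_coef_below.
  rewrite -[LHS](subrK ((S \oS Phi) n.+1)) (scomp_perturb (S := S)) //=.
    rewrite subrr lcomp0r add0r set_coef_at Phi0 lcomp1r.
    by rewrite [_ - S _]addrAC subrr sub0r addNr.
  exact: set_coef_below.
by exists Psi; apply: funext.
Qed.

(** As in a monoid in which left inverses exist: with [Theta] a left inverse of [Psi], both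
    [Phi \oS Psi] and the identity equal [Theta \oS Psi]. *)
Lemma series_inverse U (Phi : series U U) :
  Phi 0%N = lid U -> exists Psi, sinverse Phi Psi.
Proof.
move=> Phi0; have [Psi PsiK] := series_left_inverse Phi0.
have Psi0 : Psi 0%N = lid U.
  have /(congr1 (fun S => S 0%N)) := PsiK.
  by rewrite /scomp big_ord_recl big_ord0 addr0 Phi0 lcomp1r.
have [Theta ThetaK] := series_left_inverse Psi0.
exists Psi; split=> //.
by rewrite -[in LHS](scomp1l Phi) -ThetaK -(scompA Theta) PsiK scomp1r.
Qed.

End SeriesInverse.

(** * Coactions *)

Section HTensor.
Context {K : fieldType} {H : lmodType K}.
Context (muH : {linear H \ox H -> H}) (DeltaH : {linear H -> H \ox H}).
Hypothesis mulHA :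
  muH \oL (muH \ot lid H) = muH \oL (lid H \ot muH) \oL tassoc H H H.
Hypothesis coassocH : coassociative DeltaH.
Implicit Types U V W : lmodType K.

Definition hmap U V (f : {linear U -> V}) : {linear H \ox U -> H \ox V} :=
  lid H \ot f.

Lemma hmapE U V (f : {linear U -> V}) (h : H) (u : U) :
  hmap f (tens h u) = tens h (f u).
Proof. exact: tmapE. Qed.

Lemma hmap1 U : hmap (lid U) = lid (H \ox U).
Proof. exact: tmap1. Qed.

Lemma hmap_comp U V W (g : {linear V -> W}) (f : {linear U -> V}) :
  hmap (g \oL f) = hmap g \oL hmap f.
Proof. by rewrite /hmap tmap_comp lcomp1l. Qed.

Lemma mulcombE U V (h h' : H) (u : U) (v : V) :
  mulcomb muH U V (tens (tens h u) (tens h' v)) =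
  tens (muH (tens h h')) (tens u v).
Proof. by rewrite /mulcomb lcompE interchangeE tmapE. Qed.

Lemma mulcomb_natural U U' V V' (f : {linear U -> U'}) (g : {linear V -> V'}) :
  mulcomb muH U' V' \oL (hmap f \ot hmap g) =
  hmap (f \ot g) \oL mulcomb muH U V.
Proof.
apply: tensor_ext4 => h u h' v.
by rewrite [LHS]lcompE [RHS]lcompE !(tmapE, hmapE, mulcombE, lidE).
Qed.

(** This is [gmulA] for the functor [H \ox -]; on elementary tensors it reduces to associativity of
    [muH]. *)
Lemma mulcombA U V W :
  hmap (tassoc U V W) \oL mulcomb muH (U \ox V) W
    \oL (mulcomb muH U V \ot lid (H \ox W)) =
  mulcomb muH U (V \ox W) \oL (lid (H \ox U) \ot mulcomb muH V W)
    \oL tassoc (H \ox U) (H \ox V) (H \ox W).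
Proof.
apply: tensor_ext6 => a u b v c w.
rewrite [LHS]lcompE [RHS]lcompE tassocE [RHS]lcompE tmapE [LHS]lcompE.
rewrite !(tassocE, tmapE, mulcombE, hmapE, lidE).
have /(congr1 (fun h : {linear _ -> _} => h (tens (tens a b) c))) := mulHA.
by rewrite !lcompE !(tassocE, tmapE, lidE) => ->.
Qed.

(** The comultiplication of the comonad [H \ox -], counit aside; the coaction equation of a
    deformation is stated through it. *)
Definition hcomul U : {linear H \ox U -> H \ox (H \ox U)} :=
  tassoc H H U \oL (DeltaH \ot lid U).

Lemma hcomul_natural U V (f : {linear U -> V}) :
  hcomul V \oL hmap f = hmap (hmap f) \oL hcomul U.
Proof.
rewrite /hcomul /hmap -lcompA tmap_comp lcomp1l lcomp1r.
rewrite lcompA -tassoc_natural -lcompA tmap_comp tmap1.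
by rewrite lcomp1l lcomp1r.
Qed.

(** Coassociativity of the comonad: that of [DeltaH], carried through the associators by the
    pentagon. *)
Lemma hcomulA U : hmap (hcomul U) \oL hcomul U = hcomul (H \ox U) \oL hcomul U.
Proof.
transitivity (hmap (tassoc H H U) \oL tassoc H (H \ox H) U \oL
    (((lid H \ot DeltaH) \oL DeltaH) \ot lid U)).
  rewrite /hcomul hmap_comp -[in LHS]lcompA [hmap (_ \ot _) \oL _]lcompA.
  rewrite /hmap -tassoc_natural -!lcompA tmap_comp.
  by rewrite lcomp1l.
rewrite coassocH -[lid U]lcomp1l -tmap_comp -[lid U]lcomp1l -tmap_comp.
rewrite !lcompA /hmap tassoc_pentagon /hcomul !lcomp1l.
rewrite -[in RHS](lcompA (tassoc H H (H \ox U))) -tmap1.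
by rewrite -tassoc_natural !lcompA.
Qed.

Lemma sconst_hcomul_natural U V (S : series U V) :
  sconst (hcomul V) \oS (sconst (lid H) \otS S) =
  (sconst (lid H) \otS (sconst (lid H) \otS S)) \oS sconst (hcomul U).
Proof.
apply: funext => n.
rewrite scomp_constl scomp_constr !stens_constl; exact: hcomul_natural.
Qed.

Lemma sconst_mulcomb_natural U U' V V' (S : series U U') (T : series V V') :
  sconst (mulcomb muH U' V') \oS
    ((sconst (lid H) \otS S) \otS (sconst (lid H) \otS T)) =
  (sconst (lid H) \otS (S \otS T)) \oS sconst (mulcomb muH U V).
Proof.
apply: funext => n; rewrite scomp_constl scomp_constr stens_constl.
rewrite [LHS](linear_sum (mklin (@lcomp_linr K _ _ _ (mulcomb muH U' V')))).
have -> : lid H \ot (S \otS T) n =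
    \sum_(i < n.+1) lid H \ot (S i \ot T (n - i)%N).
  exact: (linear_sum (mklin (@tmap_linmr K H H _ _ (lid H)))).
rewrite [RHS](linear_sum (mklin (@lcomp_linl K _ _ _ (mulcomb muH U V)))).
by apply: eq_bigr => i _ /=; rewrite !stens_constl; exact: mulcomb_natural.
Qed.

End HTensor.

Section Coaction.
Context {K : fieldType} {H A : lmodType K}.
Context (DeltaH : {linear H -> H \ox H}).
Hypothesis coassocH : coassociative DeltaH.

Notation hser S := (sconst (lid H) \otS S).

Definition coaction_defect (R : series A (H \ox A)) :
    series A (H \ox (H \ox A)) :=
  sdiff ((sconst (lid H) \otS R) \oS R) (sconst (hcomul DeltaH A) \oS R).

Definition coaction_d1 (r phi : {linear A -> H \ox A}) :
    {linear A -> H \ox (H \ox A)} :=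
  hmap r \oL phi + hmap phi \oL r - hcomul DeltaH A \oL phi.

Definition coaction_d2 (r : {linear A -> H \ox A})
    (phi : {linear A -> H \ox (H \ox A)}) :
    {linear A -> H \ox (H \ox (H \ox A))} :=
  hmap (hmap r) \oL phi - hmap (hcomul DeltaH A) \oL phi
  + hcomul DeltaH (H \ox A) \oL phi - hmap phi \oL r.

(** The same cancellation as for [comul_d2], now by functoriality of [H \ox -], naturality of
    [hcomul] and its coassociativity [hcomulA]. *)
Lemma coaction_defect_cocycle (R : series A (H \ox A)) n :
  (forall k, (k < n)%N -> coaction_defect R k = 0) ->
  coaction_d2 (R 0%N) (coaction_defect R n) = 0.
Proof.
move=> D0; set D := coaction_defect R in D0 *.
pose dlR := sconst (hcomul DeltaH A) \oS R.
transitivity (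
  ((hser (hser R) \oS (hser R \oS R)) n - (hser (hser R) \oS dlR) n)
  - ((sconst (hmap (hcomul DeltaH A)) \oS (hser R \oS R)) n
     - (sconst (hmap (hcomul DeltaH A)) \oS dlR) n)
  + ((hser (hser R) \oS dlR) n
     - (sconst (hcomul DeltaH (H \ox A)) \oS dlR) n)
  - ((hser (hser R \oS R) \oS R) n - (hser dlR \oS R) n)).
  congr (_ - _ + _ - _).
  - rewrite -/(sdiff _ _ n) -scompBr scomp_leadr // !stens_constl //.
  - by rewrite -/(sdiff _ _ n) -scompBr scomp_constl.
  - rewrite [hser _ \oS dlR]scompA -sconst_hcomul_natural -scompA.
    by rewrite -/(sdiff _ _ n) -scompBr scomp_constl.
  - rewrite -/(sdiff _ _ n) -scompBl -stensBr scomp_leadl.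
      by rewrite stens_constl.
    by move=> k kn; rewrite stens_constl -/(coaction_defect R) -/D D0 // tmap0r.
have -> : sconst (hcomul DeltaH (H \ox A)) \oS dlR =
    sconst (hmap (hcomul DeltaH A)) \oS dlR.
  by rewrite !scompA !sconst_comp hcomulA.
rewrite !stens1l_comp stens_const -!scompA.
exact: cancel_sum4C.
Qed.

Lemma coaction_defect_perturb (R R' : series A (H \ox A)) n :
  (forall k, (k <= n)%N -> R' k = R k) ->
  coaction_defect R' n.+1 - coaction_defect R n.+1 =
  coaction_d1 (R 0%N) (R' n.+1 - R n.+1).
Proof.
move=> eR; rewrite /coaction_defect /sdiff opprD addrACA -opprD.
rewrite !scomp_constl -lcompBr scomp_perturb //; last first.
  by move=> k kn; rewrite !stens_constl eR.
by rewrite !stens_constl -tmapBr.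
Qed.

Lemma coaction_defect_local (R R' : series A (H \ox A)) n :
  (forall k, (k <= n)%N -> R' k = R k) ->
  coaction_defect R' n = coaction_defect R n.
Proof.
move=> eR; rewrite /coaction_defect /sdiff !scomp_constl eR //.
congr (_ - _); apply: eq_scomp => // k kn.
by rewrite !stens_constl eR.
Qed.

End Coaction.

(** * Deformations and formal automorphisms *)

Section Translation.
Context {K : fieldType} {H A : lmodType K}.
Context (muH : {linear H \ox H -> H}) (DeltaH : {linear H -> H \ox H}).
Context (DeltaA : {linear A -> A \ox A}) (rho : {linear A -> H \ox A}).

Notation hconv := (conv DeltaA (G := fun U => H \ox U) (mulcomb muH)).
Notation hcomul_defect :=
  (comul_defect DeltaA (G := fun U => H \ox U) (@hmap K H) (mulcomb muH)).
Notation hcomul_d1 :=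
  (comul_d1 DeltaA (G := fun U => H \ox U) (@hmap K H) (mulcomb muH)).
Notation hcomul_d2 :=
  (comul_d2 DeltaA (G := fun U => H \ox U) (@hmap K H) (mulcomb muH)).

Lemma deformationP (R : series A (H \ox A)) :
  deformation muH DeltaH DeltaA rho R <->
  [/\ R 0%N = rho, forall n, coaction_defect DeltaH R n = 0
    & forall n, hcomul_defect R n = 0].
Proof.
split=> [[R0 /sdiff_eq Rcoassoc /sdiff_eq Rcompat]|[R0 D0 E0]]; split=> //.
- exact/sdiff_eq.
- exact/sdiff_eq.
Qed.

(** Here and in the next three lemmas, unfolding signs and cofaces shows that the expressions
    attached to the defects are the differentials in degrees 1 and 2. *)
Lemma dcc0_1E (phi : {linear A -> H \ox A}) :
  dcc0 DeltaH rho 1 phi = coaction_d1 DeltaH rho phi.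
Proof.
rewrite /= /dcc0_fun big_nat1 expr1 scaleN1r sqrrN expr1n scale1r.
by rewrite /coaction_d1 addrAC.
Qed.

Lemma dcc1_1E (phi : {linear A -> H \ox A}) :
  dcc1 muH DeltaA rho 0 phi = hcomul_d1 rho phi.
Proof.
rewrite /= /dcc1_fun big_nat1 expr1 scaleN1r sqrrN expr1n scale1r /=.
rewrite /comul_d1 tmap1 lcomp1l addrAC; congr (_ - _).
by rewrite lcompDr lcompDl.
Qed.

Lemma dcc0_2E (phi : {linear A -> H \ox (H \ox A)}) :
  dcc0 DeltaH rho 2 phi = coaction_d2 DeltaH rho phi.
Proof.
rewrite /= /dcc0_fun big_nat_recl // big_nat1 expr1 sqrrN expr1n !scale1r.
by rewrite -signr_odd /= expr1 !scaleN1r /coaction_d2 addrA.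
Qed.

Lemma dcc1_2E (psi : {linear A -> H \ox (A \ox A)}) :
  dcc1 muH DeltaA rho 1 psi = hcomul_d2 rho psi.
Proof.
rewrite /= /dcc1_fun big_nat_recl // big_nat1 expr1 sqrrN expr1n !scale1r.
rewrite -signr_odd /= expr1 !scaleN1r /comul_d2 addrA.
by rewrite tmap1 lcomp1l.
Qed.

Lemma cocycle1P (phi : {linear A -> H \ox A}) :
  cocycle (C := Fcc muH DeltaH DeltaA rho) (n := 1) phi <->
  coaction_d1 DeltaH rho phi = 0 /\ hcomul_d1 rho phi = 0.
Proof.
rewrite -dcc0_1E -dcc1_1E.
split=> [d|[d0 d1]]; last exact: (congr2 pair d0 d1).
by split; [exact: (congr1 fst d)|exact: (congr1 snd d)].
Qed.

(** For the identity functor the general formulas, taken at [lid A], give the Hochschild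
    differentials. *)
Lemma delta1E (phi : {linear A -> A}) :
  delta DeltaA 0 phi =
  comul_d1 DeltaA (G := id) (fun _ _ => id) (fun U V => lid (U \ox V))
    (lid A) phi.
Proof.
rewrite /= /delta_fun big_nat1 expr1 scaleN1r sqrrN expr1n scale1r /=.
rewrite /comul_d1 !lcomp1l addrAC; congr (_ - _).
by rewrite lcompDl.
Qed.

Lemma delta2E (phi : {linear A -> A \ox A}) :
  delta DeltaA 1 phi =
  comul_d2 DeltaA (G := id) (fun _ _ => id) (fun U V => lid (U \ox V))
    (lid A) phi.
Proof.
rewrite /= /delta_fun big_nat_recl // big_nat1 expr1 sqrrN expr1n !scale1r.
rewrite -signr_odd /= expr1 !scaleN1r /comul_d2 addrA.
by rewrite tmap1 !lcomp1l lcomp1r.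
Qed.

Hypothesis bialgH : bialgebra muH DeltaH.
Hypothesis coassocA : coassociative DeltaA.
Hypothesis comodA : comodule_coalgebra muH DeltaH DeltaA rho.

Notation complex := (Fcc muH DeltaH DeltaA rho).
Notation hser S := (sconst (lid H) \otS S).
Notation is_deformation := (deformation muH DeltaH DeltaA rho).

(** * Obstructions to extending deformations *)

Lemma coaction_defect_const n : coaction_defect DeltaH (sconst rho) n = 0.
Proof.
move: n; apply/sdiff_eq.
by rewrite stens_const !sconst_comp /hcomul (comodule_coassoc comodA).
Qed.

Lemma hcomul_defect_const n : hcomul_defect (sconst rho) n = 0.
Proof.
move: n; apply/sdiff_eq.
rewrite /conv stens_const !sconst_comp.
by rewrite /hmap (comodule_coalgebra_compat comodA).
Qed.

(** The two defects in degree [n.+1] form a 2-cocycle, the obstruction; subtracting a primitive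
    [phi] of it from [R n.+1] removes both. *)
Lemma deformation_step (R : series A (H \ox A)) n :
  trivial_cohomology complex 2 -> R 0%N = rho ->
  (forall k, (k <= n)%N -> coaction_defect DeltaH R k = 0) ->
  (forall k, (k <= n)%N -> hcomul_defect R k = 0) ->
  exists R' : series A (H \ox A),
    [/\ forall k, (k <= n)%N -> R' k = R k,
        coaction_defect DeltaH R' n.+1 = 0 & hcomul_defect R' n.+1 = 0].
Proof.
move=> H2 R0 D0 E0.
pose D := coaction_defect DeltaH R n.+1; pose E := hcomul_defect R n.+1.
(* The sign of [E] matches the minus sign in [comul_defect_perturb], so that one [phi] serves both
   components. *)
have [|phi dphi] := H2 (D, - E).
  apply: (congr2 pair).
    rewrite [LHS]dcc0_2E -R0.
    exact: (coaction_defect_cocycle (bialgebra_coassoc bialgH)).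
  rewrite [LHS]linearN [X in - X]dcc1_2E -R0.
  rewrite (comul_defect_cocycle coassocA (@hmap1 K H) (@hmap_comp K H)
    (@mulcomb_natural K H muH)) ?oppr0 //.
  exact: (mulcombA (bialgebra_mulA bialgH)).
have Dphi : D = dcc0 DeltaH rho 1 phi := congr1 fst dphi.
have Ephi : - E = dcc1 muH DeltaA rho 0 phi := congr1 snd dphi.
exists (set_coef n.+1 (R n.+1 - phi) R).
have R'E k : (k <= n)%N -> set_coef n.+1 (R n.+1 - phi) R k = R k.
  exact: set_coef_below.
have R'1 : set_coef n.+1 (R n.+1 - phi) R n.+1 - R n.+1 = - phi.
  by rewrite set_coef_at addrAC subrr sub0r.
split=> //.
  rewrite -[LHS](subrK D) coaction_defect_perturb // R'1 R0 -dcc0_1E linearN.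
  by rewrite Dphi addNr.
rewrite -[LHS](subrK E) comul_defect_perturb // R'1 R0 -dcc1_1E linearN.
by rewrite -[X in - - X]Ephi opprK addNr.
Qed.

(** Comparison with the constant series, which has no defect and coefficient 0 in degree [n.+1]. *)
Lemma coaction_defect_first (R : series A (H \ox A)) n :
  (forall k, (k <= n)%N -> R k = sconst rho k) ->
  coaction_defect DeltaH R n.+1 = coaction_d1 DeltaH rho (R n.+1).
Proof.
move=> eR; have := coaction_defect_perturb DeltaH eR.
by rewrite coaction_defect_const !subr0.
Qed.

Lemma hcomul_defect_first (R : series A (H \ox A)) n :
  (forall k, (k <= n)%N -> R k = sconst rho k) ->
  hcomul_defect R n.+1 = - hcomul_d1 rho (R n.+1).
Proof.
move=> eR; have := comul_defect_perturb DeltaA (@hmap K H) (mulcomb muH) eR.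
by rewrite hcomul_defect_const !subr0.
Qed.

Lemma deformation_exists (phi : {linear A -> H \ox A}) :
  trivial_cohomology complex 2 -> cocycle (C := complex) (n := 1) phi ->
  exists R, is_deformation R /\ infinitesimal R = phi.
Proof.
move=> H2 /cocycle1P[phiD phiE].
pose P n (R : series A (H \ox A)) :=
  [/\ R 0%N = rho, coaction_defect DeltaH R n = 0 & hcomul_defect R n = 0].
have S0E k : (k <= 0)%N -> set_coef 1 phi (sconst rho) k = sconst rho k.
  exact: set_coef_below.
(* The start [rho + phi t] has no defect through degree 1 because [phi] is a cocycle; taking 1 as
   initial degree keeps the infinitesimal fixed. *)
have [||n R n1 RP|R [R01 RP]] :=
  @stepwise_limit _ P 1 (set_coef 1 phi (sconst rho)).
- move=> n S S' eS [S0 SD SE]; split; first by rewrite eS.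
    by rewrite (coaction_defect_local _ eS).
  by rewrite (comul_defect_local _ _ _ eS).
- case=> [|[|//]] _; split=> //.
  + by rewrite (coaction_defect_local _ S0E) coaction_defect_const.
  + by rewrite (comul_defect_local _ _ _ S0E) hcomul_defect_const.
  + by rewrite coaction_defect_first // set_coef_at.
  + by rewrite hcomul_defect_first // set_coef_at phiE oppr0.
- have [||||R' [eR R'D R'E]] := @deformation_step R n => //.
  + by have [] := RP 0%N isT.
  + by move=> k /RP[].
  + by move=> k /RP[].
  exists R'; split=> //; split=> //; rewrite eR //; by have [] := RP 0%N isT.
exists R; split; last by rewrite /infinitesimal R01 // set_coef_at.
apply/deformationP; split; first by have [] := RP 0%N.
- by move=> n; have [] := RP n.
- by move=> n; have [] := RP n.
Qed.

Lemma infinitesimal_cocycle (R : series A (H \ox A)) :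
  is_deformation R -> cocycle (C := complex) (n := 1) (infinitesimal R).
Proof.
move=> /deformationP[R0 D0 E0]; apply/cocycle1P.
have eR k : (k <= 0)%N -> R k = sconst rho k by case: k.
split; first by rewrite -(coaction_defect_first eR) D0.
by apply/oppr_inj; rewrite -(hcomul_defect_first eR) E0 oppr0.
Qed.

(** * Formal automorphisms and rigidity *)

Notation acomul_defect :=
  (comul_defect DeltaA (G := id) (fun _ _ => id) (fun U V => lid (U \ox V))).
Notation acomul_d1 :=
  (comul_d1 DeltaA (G := id) (fun _ _ => id) (fun U V => lid (U \ox V))).

Lemma formal_automorphismP (Phi : series A A) :
  formal_automorphism DeltaA Phi <->
  Phi 0%N = lid A /\ forall n, acomul_defect Phi n = 0.
Proof.
have defectE : acomul_defect Phi =
    sdiff (sconst DeltaA \oS Phi) ((Phi \otS Phi) \oS sconst DeltaA).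
  by rewrite /comul_defect /conv scomp1l.
by split=> [[Phi0 PhiD]|[Phi0 PhiD]]; split=> //;
  [rewrite defectE; exact/sdiff_eq | apply/sdiff_eq; rewrite -defectE].
Qed.

Lemma acomul_defect_const n : acomul_defect (sconst (lid A)) n = 0.
Proof.
move: n; apply/sdiff_eq; rewrite /conv stens_const !sconst_comp tmap1.
by rewrite !lcomp1l lcomp1r.
Qed.

Lemma acomul_defect_first (Phi : series A A) n :
  (forall k, (k <= n)%N -> Phi k = sconst (lid A) k) ->
  acomul_defect Phi n.+1 = - acomul_d1 (lid A) (Phi n.+1).
Proof.
move=> eR; have := @comul_defect_perturb _ _ DeltaA id (fun _ _ => id)
  (fun U V => lid (U \ox V)) _ _ _ eR.
by rewrite acomul_defect_const !subr0.
Qed.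

Lemma coder_predP (phi : {linear A -> A}) :
  phi \in coder_pred DeltaA <-> acomul_d1 (lid A) phi = 0.
Proof.
rewrite /comul_d1 lcomp1l; split=> [/asboolP ->|/eqP]; first exact: subrr.
by rewrite subr_eq0 => /eqP e; apply/asboolP.
Qed.

(** As [phi] is a coderivation, [Id + phi t^(n+1)] is an automorphism through degree [n.+1]; each
    later obstruction is a Hochschild 2-cocycle, hence a coboundary. *)
Lemma automorphism_exists n (phi : {linear A -> A}) :
  trivial_cohomology (Cc DeltaA) 2 -> phi \in coder_pred DeltaA ->
  exists Psi, [/\ formal_automorphism DeltaA Psi,
    forall k, (k <= n)%N -> Psi k = sconst (lid A) k & Psi n.+1 = phi].
Proof.
move=> Hc2 /coder_predP phiC.
pose P k (Psi : series A A) := Psi 0%N = lid A /\ acomul_defect Psi k = 0.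
pose Psi0 := set_coef n.+1 phi (sconst (lid A)).
have Psi0E k : (k <= n)%N -> Psi0 k = sconst (lid A) k by exact: set_coef_below.
have [|||Psi [PsiE PsiP]] := @stepwise_limit _ P n.+1 Psi0.
- move=> k S S' eS [S0 SE]; split; first by rewrite eS.
  by rewrite (comul_defect_local _ _ _ eS).
- move=> k; rewrite leq_eqVlt => /predU1P[->|]; last rewrite ltnS => kn.
    by split=> //; rewrite acomul_defect_first // /Psi0 set_coef_at phiC oppr0.
  split=> //; rewrite (@comul_defect_local _ _ _ _ _ _ (sconst (lid A))).
    exact: acomul_defect_const.
  by move=> j jk; apply: Psi0E; exact: leq_trans jk kn.
- move=> k S _ SP; have [S0 _] := SP 0%N isT.
  have [|sigma Esigma] := Hc2 (acomul_defect S k.+1).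
    rewrite /cocycle [LHS]delta2E -S0.
    apply: comul_defect_cocycle => //.
    - by move=> *; rewrite lcomp1l lcomp1r.
    - by move=> *; rewrite !tmap1 !lcomp1l !lcomp1r.
    - by move=> j; rewrite ltnS => /SP[].
  (* Here [sigma] is added, not subtracted, because [comul_defect_perturb] already carries a minus
     sign. *)
  have S'E j : (j <= k)%N -> set_coef k.+1 (S k.+1 + sigma) S j = S j.
    exact: set_coef_below.
  exists (set_coef k.+1 (S k.+1 + sigma) S); split=> //.
  split; first by rewrite S'E.
  rewrite -[LHS](subrK (acomul_defect S k.+1)) comul_defect_perturb //.
  rewrite set_coef_at addrAC subrr add0r S0 -delta1E.
  by rewrite [X in _ + X]Esigma addNr.
exists Psi; split.
- apply/formal_automorphismP; split; first by have [] := PsiP 0%N.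
  by move=> k; have [] := PsiP k.
- by move=> k kn; rewrite PsiE ?Psi0E // ltnW.
- by rewrite PsiE // /Psi0 set_coef_at.
Qed.

Lemma formal_automorphism_comp (Phi Psi : series A A) :
  formal_automorphism DeltaA Phi -> formal_automorphism DeltaA Psi ->
  formal_automorphism DeltaA (Phi \oS Psi).
Proof.
move=> [Phi0 PhiD] [Psi0 PsiD]; split.
  by rewrite /scomp big_ord_recl big_ord0 addr0 Phi0 Psi0 lcomp1l.
by rewrite scompA PhiD -scompA PsiD scompA stens_comp.
Qed.

(* It vanishes when (Phi, Phi^-1) makes R equivalent to the constant series. *)
Definition gauge_defect (R : series A (H \ox A)) (Phi : series A A) :
    series A (H \ox A) :=
  sdiff (R \oS Phi) (hser Phi \oS sconst rho).

Lemma gauge_defect_local (R : series A (H \ox A)) (Phi Phi' : series A A) n :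
  (forall k, (k <= n)%N -> Phi' k = Phi k) ->
  gauge_defect R Phi' n = gauge_defect R Phi n.
Proof.
move=> ePhi; rewrite /gauge_defect /sdiff !scomp_constr !stens_constl ePhi //.
by congr (_ - _); exact: eq_scomp.
Qed.

(** With [T = R \oS Phi] and [S] the transport of [rho] along [Phi], both are multiplicative for
    [hconv], and both satisfy mixed coaction equations with [R] or [rho]; the difference [T - S]
    therefore satisfies linearised equations in lowest degree. *)
Lemma gauge_defect_cocycle (R : series A (H \ox A)) (Phi : series A A) n :
  is_deformation R -> formal_automorphism DeltaA Phi ->
  (forall k, (k < n)%N -> gauge_defect R Phi k = 0) ->
  cocycle (C := complex) (n := 1) (gauge_defect R Phi n).
Proof.
move=> [R0 Rcoassoc Rcompat] [Phi0 PhiD]; set G := gauge_defect R Phi => G0.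
have RPhi0 : (R \oS Phi) 0%N = rho.
  by rewrite /scomp big_ord_recl big_ord0 addr0 R0 Phi0 lcomp1r.
have Phirho0 : (hser Phi \oS sconst rho) 0%N = rho.
  by rewrite scomp_constr stens_constl Phi0 tmap1 lcomp1l.
apply/cocycle1P; split.
  transitivity (((hser R \oS (R \oS Phi)) n
      - (hser R \oS (hser Phi \oS sconst rho)) n)
    + ((hser (R \oS Phi) \oS sconst rho) n
      - (hser (hser Phi \oS sconst rho) \oS sconst rho) n)
    - ((sconst (hcomul DeltaH A) \oS (R \oS Phi)) n
      - (sconst (hcomul DeltaH A) \oS (hser Phi \oS sconst rho)) n)).
    congr (_ + _ - _).
    - by rewrite -/(sdiff _ _ n) -scompBr scomp_leadr // stens_constl R0.
    - by rewrite -/(sdiff _ _ n) -scompBl -stensBr scomp_constr stens_constl.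
    - by rewrite -/(sdiff _ _ n) -scompBr scomp_constl.
  have -> : hser R \oS (R \oS Phi) = sconst (hcomul DeltaH A) \oS (R \oS Phi).
    by rewrite scompA Rcoassoc scompA.
  have -> : hser R \oS (hser Phi \oS sconst rho) =
      hser (R \oS Phi) \oS sconst rho.
    by rewrite scompA stens1l_comp.
  have -> : hser (hser Phi \oS sconst rho) \oS sconst rho =
      sconst (hcomul DeltaH A) \oS (hser Phi \oS sconst rho).
    rewrite stens1l_comp scompA sconst_hcomul_natural -!scompA stens_const.
    by rewrite !sconst_comp (comodule_coassoc comodA).
  by rewrite subrKA subrr.
(* The derivation identity: [T * T - S * S] is [T * (T - S) + (T - S) * S]. *)
transitivity ((hconv (R \oS Phi) (R \oS Phi) n
    - hconv (R \oS Phi) (hser Phi \oS sconst rho) n)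
  + (hconv (R \oS Phi) (hser Phi \oS sconst rho) n
    - hconv (hser Phi \oS sconst rho) (hser Phi \oS sconst rho) n)
  - ((sconst (hmap DeltaA) \oS (R \oS Phi)) n
    - (sconst (hmap DeltaA) \oS (hser Phi \oS sconst rho)) n)).
  rewrite /comul_d1; congr (_ - _); last first.
    by rewrite -/(sdiff _ _ n) -scompBr scomp_constl.
  rewrite -!/(sdiff _ _ n) -convBr -convBl !convE lcompDr lcompDl.
  by rewrite stens_leadr // stens_leadl // RPhi0 Phirho0.
have -> : hconv (R \oS Phi) (R \oS Phi) =
    sconst (hmap DeltaA) \oS (R \oS Phi).
  by rewrite /conv -stens_comp -!scompA -PhiD !scompA /hmap Rcompat.
have -> : hconv (hser Phi \oS sconst rho) (hser Phi \oS sconst rho) =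
    sconst (hmap DeltaA) \oS (hser Phi \oS sconst rho).
  rewrite /conv -stens_comp !scompA sconst_mulcomb_natural stens_const.
  rewrite -!scompA !sconst_comp lcompA -(comodule_coalgebra_compat comodA).
  rewrite -sconst_comp -stens_const !scompA -!stens1l_comp.
  by rewrite -PhiD.
by rewrite subrKA subrr.
Qed.

(** The first nonzero gauge defect is [d^0] of a coderivation [phi]; composing [Phi] with an
    automorphism that begins with [Id - phi t^(n+1)] cancels it. *)
Lemma gauge_step (R : series A (H \ox A)) (Phi : series A A) n :
  trivial_cohomology (Cc DeltaA) 2 -> trivial_cohomology complex 1 ->
  is_deformation R -> formal_automorphism DeltaA Phi ->
  (forall k, (k <= n)%N -> gauge_defect R Phi k = 0) ->
  exists Phi', [/\ formal_automorphism DeltaA Phi',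
    forall k, (k <= n)%N -> Phi' k = Phi k & gauge_defect R Phi' n.+1 = 0].
Proof.
move=> Hc2 H1 Rdef Phi_auto G0.
have [|phi Gphi] := H1 (gauge_defect R Phi n.+1).
  exact: gauge_defect_cocycle.
have [|Psi [Psi_auto PsiE Psi1]] :=
  @automorphism_exists n (- coder_val phi) Hc2.
  by rewrite rpredN coderP.
exists (Phi \oS Psi); split; first exact: formal_automorphism_comp.
  move=> k kn; rewrite -[in RHS](scomp1r Phi); apply: eq_scomp => // j jk.
  by apply: PsiE; exact: leq_trans jk kn.
(* The defect of a composite telescopes through the transport of [rho] along [Phi], followed by
   [Psi]. *)
have -> : gauge_defect R (Phi \oS Psi) n.+1 =
    (gauge_defect R Phi \oS Psi) n.+1
    + (hser Phi \oS gauge_defect (sconst rho) Psi) n.+1.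
  rewrite scompBl scompBr /gauge_defect /sdiff stens1l_comp !scompA.
  by rewrite subrKA.
have first k : (k <= n)%N -> gauge_defect (sconst rho) Psi k = 0.
  move=> kn; rewrite (@gauge_defect_local _ (sconst (lid A))); last first.
    by move=> j jk; apply: PsiE; exact: leq_trans jk kn.
  move: {kn}k; apply/sdiff_eq.
  by rewrite stens_const tmap1 scomp1l scomp1r.
have [[Psi0 _] [Phi0 _]] := (Psi_auto, Phi_auto).
rewrite scomp_leadl ?Psi0 ?lcomp1r // scomp_leadr //.
rewrite stens_constl Phi0 tmap1 lcomp1l Gphi /gauge_defect /sdiff.
rewrite scomp_constl scomp_constr stens_constl Psi1.
rewrite lcompNr tmapNr lcompNl -opprD.
exact: subrr.
Qed.

Lemma rigidity :
  trivial_cohomology (Cc DeltaA) 2 -> trivial_cohomology complex 1 ->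
  rigid muH DeltaH DeltaA rho.
Proof.
move=> Hc2 H1 R Rdef.
have [R0 _ _] := Rdef.
(* Being an automorphism involves all coefficients, whereas [stepwise_limit] needs a condition on
   those through degree [n]; hence [Phi] is only asked to agree that far with an automorphism
   [Phi']. *)
pose P n (Phi : series A A) := exists Phi', [/\ formal_automorphism DeltaA Phi',
  forall k, (k <= n)%N -> Phi' k = Phi k &
  forall k, (k <= n)%N -> gauge_defect R Phi' k = 0].
have [|||Phi [_ PhiP]] := @stepwise_limit _ P 0 (sconst (lid A)).
- move=> n S S' eS [Phi' [Phi'a Phi'E Phi'G]]; exists Phi'; split=> // k kn.
  by rewrite eS // Phi'E.
- case=> // _; exists (sconst (lid A)); split=> //.
    by apply/formal_automorphismP; split=> // n; exact: acomul_defect_const.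
  case=> // _; rewrite /gauge_defect /sdiff scomp_constr lcomp1r scomp_constr.
  by rewrite stens_constl /= tmap1 lcomp1l R0 subrr.
(* The step continues from [Phi'], since [S] is uncontrolled above degree [n]. *)
- move=> n S _ /(_ n (leqnn n))[Phi' [Phi'a Phi'E Phi'G]].
  have [Phi'' [Phi''a Phi''E Phi''G]] := gauge_step Hc2 H1 Rdef Phi'a Phi'G.
  exists Phi''; split=> [k kn|]; first by rewrite Phi''E // Phi'E.
  exists Phi''; split=> // k; rewrite leq_eqVlt => /predU1P[->|] //.
  rewrite ltnS => kn; rewrite (gauge_defect_local _ (Phi := Phi')) ?Phi'G //.
  by move=> j jk; apply: Phi''E; exact: leq_trans jk kn.
(* Each coefficient of the equation for the limit is read off from the automorphism that agrees with
   it that far. *)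
have Phi_auto : formal_automorphism DeltaA Phi.
  apply/formal_automorphismP; split=> [|n].
    by have [Phi' [[Phi'0 _] <- //]] := PhiP 0%N.
  have [Phi' [/formal_automorphismP[_ Phi'D] Phi'E _]] := PhiP n.
  by rewrite -(comul_defect_local _ _ _ Phi'E).
have RPhi : R \oS Phi = hser Phi \oS sconst rho.
  apply/sdiff_eq => n; have [Phi' [_ Phi'E Phi'G]] := PhiP n.
  by rewrite -/(gauge_defect R Phi n) -(gauge_defect_local _ Phi'E) Phi'G.
have [PhiV PhiVK] := series_inverse (formal_automorphism0 Phi_auto).
exists Phi, PhiV; split=> //; case: PhiVK => PhiVK _.
by rewrite -scompA RPhi scompA -stens1l_comp PhiVK stens_const tmap1 scomp1l.
Qed.

(** Comparing coefficients of degree 1 after moving [PhiV] to the other side shows that the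
    infinitesimals differ by [d^0] of [- Phi 1%N]. *)
Lemma equivalent_cohomologous (R Rbar : series A (H \ox A)) :
  is_deformation R -> is_deformation Rbar -> equivalent DeltaA R Rbar ->
  cohomologous (C := complex) (n := 1) (infinitesimal R) (infinitesimal Rbar).
Proof.
move=> [R0 _ _] [Rbar0 _ _] [Phi [PhiV [Phi_auto [_ PhiVK] Rbar_eq]]].
have RPhi : hser Phi \oS Rbar = R \oS Phi.
  by rewrite Rbar_eq !scompA -stens1l_comp PhiVK stens_const tmap1 scomp1l.
have /formal_automorphismP[Phi0 PhiD] := Phi_auto.
(* In degree 1 the automorphism equation is the coderivation equation for [Phi 1%N]. *)
have Phi1 : Phi 1%N \in coder_pred DeltaA.
  apply/coder_predP/oppr_inj; rewrite -acomul_defect_first ?PhiD ?oppr0 //.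
  by case.
have Phi1N : - Phi 1%N \in coder_pred DeltaA by rewrite rpredN.
exists (Coder Phi1N).
have := congr1 (fun S => S 1%N) RPhi.
rewrite /scomp !big_ord_recl !big_ord0 !addr0 /= !stens_constl Phi0 R0 Rbar0.
rewrite tmap1 lcomp1l lcomp1r => RPhi1.
have -> : dcc_init_fun rho (Coder Phi1N) =
    - (rho \oL Phi 1%N) + (lid H \ot Phi 1%N) \oL rho.
  by rewrite /dcc_init_fun lcompNr tmapNr lcompNl opprK.
apply: (addrI (rho \oL Phi 1%N)); rewrite addrA -[X in X - _]RPhi1 addNKr.
by rewrite addrAC [X in X + _]subrr add0r.
Qed.

End Translation.

Theorem theorem5p8 (K : fieldType) (H A : lmodType K)
    (muH : {linear H \ox H -> H}) (DeltaH : {linear H -> H \ox H})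
    (DeltaA : {linear A -> A \ox A}) (rho : {linear A -> H \ox A})
    (Hbialg : bialgebra muH DeltaH) (Acoalg : coassociative DeltaA)
    (Acomod : comodule_coalgebra muH DeltaH DeltaA rho) :
  [/\ forall R : series A (H \ox A),
        deformation muH DeltaH DeltaA rho R ->
        cocycle (C := Fcc muH DeltaH DeltaA rho) (n := 1) (infinitesimal R),
      forall R Rbar : series A (H \ox A),
        deformation muH DeltaH DeltaA rho R ->
        deformation muH DeltaH DeltaA rho Rbar ->
        equivalent DeltaA R Rbar ->
        cohomologous (C := Fcc muH DeltaH DeltaA rho) (n := 1)
          (infinitesimal R) (infinitesimal Rbar),
      trivial_cohomology (Cc DeltaA) 2 ->
        trivial_cohomology (Fcc muH DeltaH DeltaA rho) 1 ->
        rigid muH DeltaH DeltaA rho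
    & trivial_cohomology (Fcc muH DeltaH DeltaA rho) 2 ->
        forall phi : Fcc muH DeltaH DeltaA rho 1%N, cocycle phi ->
        exists R : series A (H \ox A),
          deformation muH DeltaH DeltaA rho R /\ infinitesimal R = phi ].
Proof.
split.
- move=> R; exact: infinitesimal_cocycle.
- move=> R Rbar; exact: equivalent_cohomologous.
- exact: rigidity.
- move=> H2 phi; exact: deformation_exists.
Qed.
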